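(* Let $k,\ell\ge1$ be fixed. Let $\boldsymbol\alpha=(\alpha_1,\ldots,\alpha_k)$ be constants with $\alpha_i>0$ and $\sum_i\alpha_i=1$, and let $\boldsymbol\beta=(\beta_1,\ldots,\beta_\ell)$ be constants with $\beta_j>0$ and $\sum_j\beta_j=1$. Let $\mathbf{c}_1=(c_{1,1},\ldots,c_{1,n})\in[k]^n$ be an arbitrary sequence, and let $\mathbf{c}_2=(c_{2,1},\ldots,c_{2,n})\in[\ell]^n$ be an arbitrary sequence in which each color $j\in[\ell]$ appears exactly $\beta_j n$ times. Let $p=K\log n/n$ with $K$ sufficiently large. Color the vertices of $[n]$ so that exactly $\beta_j n$ vertices receive color $j$ for each $j\in[\ell]$, and give each edge of $G_{n,p}$ independently a random color from $[k]$, color $i$ with probability $\alpha_i$. Then with probability tending to $1$ as $n\to\infty$, this colored graph contains a Hamilton cycle $(x_1,\ldots,x_n,x_1)$ such that $c(\{x_i,x_{i+1}\})=c_{1,i}$ for all $i\in[n]$ (with $x_{n+1}=x_1$) and $c(x_i)=c_{2,i}$ for all $i\in[n]$.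
   Context: $G_{n,p}$ is the random graph on vertex set $[n]$ in which each of the $\binom n2$ possible edges is present independently with probability $p$. $c(e)$ denotes the color of edge $e$ and $c(v)$ the color of vertex $v$. *)

(* Defs.v *)
From mathcomp Require Import all_boot all_order all_fingroup all_algebra.
From mathcomp Require Import all_classical all_reals all_analysis.

Set Implicit Arguments.
Unset Strict Implicit.
Unset Printing Implicit Defensive.

Import Order.TTheory GRing.Theory Num.Theory.
Local Open Scope ring_scope.

Notation vpair n := {e : {set 'I_n} | #|e| == 2%N}.

(* An edge-coloured graph on 'I_n : [g e = None] when the pair [e] is not an
   edge, and [g e = Some i] when it is an edge of colour [i]. *)
Notation ecgraph n k := {ffun vpair n -> option 'I_k}.

(* The law of G_{n,p} with independently coloured edges: independently for each
   pair, it is absent with probability 1 - p, and present with colour i with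
   probability p * alpha i. *)
Definition ecgraph_weight (R : realType) (n k : nat) (p : R)
    (alpha : 'I_k -> R) (g : ecgraph n k) : R :=
  \prod_(e : vpair n) (if g e is Some i then p * alpha i else 1 - p).

Definition ecgraph_prob (R : realType) (n k : nat) (p : R)
    (alpha : 'I_k -> R) (A : pred (ecgraph n k)) : R :=
  \sum_(g : ecgraph n k | A g) ecgraph_weight p alpha g.

(* [ordS] is the cyclic successor on 'I_n, so that i ranges over all n edges
   x_i x_{i+1} of the cycle, including the closing one. *)
Definition has_coloured_ham_cycle (n k l : nat) (cv : 'I_n -> 'I_l)
    (c1 : 'I_n -> 'I_k) (c2 : 'I_n -> 'I_l) (g : ecgraph n k) : bool :=
  (2 < n)%N &&
  [exists x : {perm 'I_n}, [forall i : 'I_n,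
    (cv (x i) == c2 i) &&
    [exists e : vpair n,
      (val e == [set x i; x (ordS i)]%SET) && (g e == Some (c1 i))]]].

Definition colour_counts (R : realType) (n l : nat) (beta : 'I_l -> R)
    (c : 'I_n -> 'I_l) : Prop :=
  forall j : 'I_l, #|[set v : 'I_n | c v == j]%SET|%:R = beta j * n%:R.

(* Main.v *)
Require Import Defs.
From mathcomp Require Import all_boot all_order all_fingroup all_algebra.
From mathcomp Require Import all_classical all_reals all_analysis.
From mathcomp Require Import ring lra zify.

(* Colours of edges.  By McDiarmid's replacement argument, the probability of a
   cycle with the prescribed edge colours is at least the probability that a
   random set of pairs of density q = p * min_i alpha_i contains a Hamilton
   cycle with the prescribed vertex colours.

   Spread.  Among the colour-respecting bijections from positions to vertices,
   the proportion of those whose cycle contains a given set U of pairs is at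
   most kappa^-|U| with kappa of order n: the cycle enters each edge of U at
   one of its two ends, the initial vertices of the paths formed by U then
   determine the positions of all vertices touched by U, and fixing the
   positions of m vertices of a class of size N costs a factor N(N-1)...(N-m+1).

   Threshold.  Expose the random set in O(log n) independent rounds.  A round
   of density 8/kappa replaces each member S_a of the family by a smallest set
   S_b \ W with S_b included in W and S_a together.  As W together with this
   fragment determines the fragment up to the choice of a subset of a single
   member of the family, few fragments are larger than half the previous size,
   and the others still form a spread family.  Once the fragments are smaller
   than a small multiple of log n, one round of density log n / kappa covers
   one of them with high probability. *)

Set Implicit Arguments.
Unset Strict Implicit.
Unset Printing Implicit Defensive.

Import Order.TTheory GRing.Theory Num.Theory.
Local Open Scope classical_set_scope.
Local Open Scope ring_scope.

(** * Random sets as averaging operators *)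

Definition sprinkle1 (R : realType) (E : finType) (p : R) (e : E)
    (F : {set E} -> R) (W : {set E}) : R :=
  p * F (e |: W)%SET + (1 - p) * F W.

(* [sprinkle p s F W] is the expectation of F at the union of W and a random
   subset of s of density p; in this operator form, independent random sets
   are combined by composition. *)
Definition sprinkle (R : realType) (E : finType) (p : R) (s : seq E)
    (F : {set E} -> R) : {set E} -> R :=
  foldr (sprinkle1 p) F s.

Definition decreasing (R : realType) (E : finType) (F : {set E} -> R) : Prop :=
  forall A B : {set E}, A \subset B -> F B <= F A.

Lemma sprinkle1C (R : realType) (E : finType) (p q : R) (e e' : E)
    (F : {set E} -> R) :
  sprinkle1 p e (sprinkle1 q e' F) = sprinkle1 q e' (sprinkle1 p e F).
Proof. by apply/funext => W; rewrite /sprinkle1 finset.setUCA; ring. Qed.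

Lemma sprinkle_op (R : realType) (E : finType) (p q : R) (s : seq E) (e : E)
    (F : {set E} -> R) :
  sprinkle p s (sprinkle1 q e F) = sprinkle1 q e (sprinkle p s F).
Proof. by elim: s => //= e' s ->; rewrite sprinkle1C. Qed.

Lemma sprinkle1_le (R : realType) (E : finType) (p : R) (e : E)
    (F G : {set E} -> R) :
  0 <= p <= 1 -> (forall W, F W <= G W) ->
  forall W, sprinkle1 p e F W <= sprinkle1 p e G W.
Proof.
move=> /andP[p0 p1] FG W; apply: lerD; apply: ler_wpM2l => //.
by rewrite subr_ge0.
Qed.

Lemma sprinkle_le (R : realType) (E : finType) (p : R) (s : seq E)
    (F G : {set E} -> R) :
  0 <= p <= 1 -> (forall W, F W <= G W) ->
  forall W, sprinkle p s F W <= sprinkle p s G W.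
Proof. by move=> p01 FG; elim: s => //= e s IH; exact: sprinkle1_le. Qed.

Lemma sprinkle1_decreasing (R : realType) (E : finType) (p : R) (e : E)
    (F : {set E} -> R) :
  0 <= p <= 1 -> decreasing F -> decreasing (sprinkle1 p e F).
Proof.
move=> /andP[p0 p1] dF A B AB; apply: lerD; apply: ler_wpM2l.
- by [].
- by apply: dF; apply: finset.setUS.
- by rewrite subr_ge0.
- exact: dF.
Qed.

Lemma sprinkle_decreasing (R : realType) (E : finType) (p : R) (s : seq E)
    (F : {set E} -> R) :
  0 <= p <= 1 -> decreasing F -> decreasing (sprinkle p s F).
Proof. by move=> p01 dF; elim: s => //= e s IH; exact: sprinkle1_decreasing. Qed.

(** Two independent chances add [e] with probability [p1 + p2 - p1 * p2], which is at most [q]; a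
    decreasing [F] can only gain from adding [e] less often. *)
Lemma sprinkle1_thin (R : realType) (E : finType) (p1 p2 q : R) (e : E)
    (F : {set E} -> R) :
  0 <= p1 -> 0 <= p2 -> p1 + p2 <= q -> decreasing F ->
  forall W, sprinkle1 q e F W <= sprinkle1 p1 e (sprinkle1 p2 e F) W.
Proof.
move=> p10 p20 pq dF W; rewrite /sprinkle1 finset.setUA finset.setUid.
have : 0 <= F W - F (e |: W)%SET by rewrite subr_ge0 dF // finset.subsetUr.
set a := F W; set b := F _ => ab0.
rewrite -subr_ge0.
suff -> : p1 * (p2 * b + (1 - p2) * b) + (1 - p1) * (p2 * b + (1 - p2) * a) -
   (q * b + (1 - q) * a) = (q - (p1 + p2) + p1 * p2) * (a - b).
  by rewrite mulr_ge0 // addr_ge0 ?mulr_ge0 // subr_ge0.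
by ring.
Qed.

Lemma sprinkle_thin (R : realType) (E : finType) (p1 p2 q : R) (s : seq E)
    (F : {set E} -> R) :
  0 <= p1 -> 0 <= p2 -> p1 + p2 <= q -> q <= 1 -> decreasing F ->
  forall W, sprinkle q s F W <= sprinkle p1 s (sprinkle p2 s F) W.
Proof.
move=> p10 p20 pq q1 dF.
have q01 : 0 <= q <= 1 by rewrite q1 (le_trans _ pq) ?addr_ge0.
have p101 : 0 <= p1 <= 1 by apply/andP; split => //; lra.
have p201 : 0 <= p2 <= 1 by apply/andP; split => //; lra.
elim: s => [|e s IH] W //=.
rewrite -/(sprinkle q s F) -/(sprinkle p1 s _) -/(sprinkle p2 s F).
(* Commuting brings the two operators at [e] side by side, where the one-element case applies. *)
rewrite sprinkle_op.
apply: (@le_trans _ _ (sprinkle1 p1 e (sprinkle1 p2 e (sprinkle q s F)) W)).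
  by apply: sprinkle1_thin => //; exact: sprinkle_decreasing.
by apply: sprinkle1_le => // ?; apply: sprinkle1_le.
Qed.

Lemma sum_subsetU1 (R : realType) (E : finType) (e : E) (A : {set E})
    (f : {set E} -> R) :
  e \notin A ->
  \sum_(W : {set E} | W \subset e |: A) f W =
  \sum_(W : {set E} | W \subset A) f (e |: W)%SET +
  \sum_(W : {set E} | W \subset A) f W.
Proof.
move=> eA; rewrite (bigID (fun W : {set E} => e \in W)) /=; congr (_ + _).
  rewrite (reindex_onto (fun W : {set E} => e |: W)%SET (fun W => W :\ e)%SET).
    apply: eq_bigl => W; rewrite finset.setU11 andbT.
    apply/andP/idP => [[WA /eqP<-]|WA].
      by rewrite finset.subDset.
    rewrite finset.setUS //; split=> //; apply/eqP/finset.setU1K.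
    by apply: contra eA => /(fintype.subsetP WA).
  by move=> W /andP[_ eW]; rewrite finset.setD1K.
apply: eq_bigl => W; apply/andP/idP => [[WA eW]|WA].
  by apply/fintype.subsetP => x xW; have := fintype.subsetP WA x xW;
    rewrite !inE => /predU1P[xe|//]; rewrite -xe xW in eW.
split; first by rewrite (fintype.subset_trans WA) // finset.subsetUr.
by apply: contra eA => /(fintype.subsetP WA).
Qed.

Definition bern_weight (R : realType) (E : finType) (p : R) (W : {set E}) : R :=
  \prod_(e : E) (if e \in W then p else 1 - p).

Lemma sprinkleE (R : realType) (E : finType) (p : R) (F : {set E} -> R) W0 :
  sprinkle p (enum E) F W0 =
  \sum_(W : {set E}) bern_weight p W * F (W0 :|: W)%SET.
Proof.
(* For the induction only the elements of a duplicate-free [s] are random, so both the subsets and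
   the weights are restricted to [s]. *)
suff H : forall (s : seq E) W0, uniq s -> sprinkle p s F W0 =
    \sum_(W : {set E} | W \subset [set x in s]%SET)
      (\prod_(e <- s) (if e \in W then p else 1 - p)) * F (W0 :|: W)%SET.
  rewrite H ?enum_uniq //; apply: eq_big => [W|W _].
    by apply/fintype.subsetP => x _; rewrite inE mem_enum.
  by rewrite /bern_weight big_enum.
elim=> [|e s IH] {}W0 /=.
  rewrite (big_pred1 finset.set0) => [_|W].
    by rewrite big_nil mul1r finset.setU0.
  by rewrite /= -finset.subset0; congr (_ \subset _); apply/finset.setP => x; rewrite !inE.
case/andP => es us; rewrite -/(sprinkle p s F) /sprinkle1 !IH //.
rewrite (_ : [set x in e :: s]%SET = (e |: [set x in s])%SET); last first.
  by apply/finset.setP => x; rewrite !inE.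
rewrite sum_subsetU1 ?inE // !big_distrr /=; congr (_ + _).
  apply: eq_bigr => W Ws; rewrite big_cons finset.setU11 mulrA finset.setUCA finset.setUA; congr (_ * _ * _).
  apply: eq_big_seq => x xs; rewrite !inE; case: eqP => // xe.
  by rewrite -xe xs in es.
apply: eq_bigr => W Ws; rewrite big_cons mulrA; congr (_ * _ * _).
suff /negbTE-> : e \notin W by [].
by apply: contra es => /(fintype.subsetP Ws); rewrite inE.
Qed.

Lemma bern_weight_ge0 (R : realType) (E : finType) (p : R) (W : {set E}) :
  0 <= p <= 1 -> 0 <= bern_weight p W.
Proof.
by move=> /andP[p0 p1]; apply: prodr_ge0 => e _; case: ifP => // _; rewrite subr_ge0.
Qed.

Lemma sum_bern_weight (R : realType) (E : finType) (p : R) :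
  \sum_(W : {set E}) bern_weight p W = 1.
Proof.
(* The total weight is the expectation of the constant 1, which every averaging operator
   preserves. *)
have := sprinkleE p (fun=> 1) (finset.set0 : {set E}).
under eq_bigr do rewrite mulr1.
move=> <-; elim: (enum E) finset.set0 => //= e s IH W.
by rewrite /sprinkle1 !IH; ring.
Qed.

(** Factor by factor: at an element of [T] the weight changes from [p] to [1 - p], and
    [1 - p <= 1 = p * p^-1]. *)
Lemma bern_weightD (R : realType) (E : finType) (p : R) (Z T : {set E}) :
  0 < p <= 1 -> T \subset Z ->
  bern_weight p (Z :\: T)%SET <= bern_weight p Z * p^-1 ^+ #|T|.
Proof.
move=> /andP[p0 p1] TZ; rewrite /bern_weight -prodr_const.
rewrite [X in _ * X]big_mkcond -big_split /=.
apply: ler_prod => e _; rewrite !inE.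
case: (boolP (e \in T)) => eT /=; last first.
  rewrite mulr1 lexx andbT; case: ifP => _; [exact: ltW | by rewrite subr_ge0].
rewrite (fintype.subsetP TZ _ eT) divff ?gt_eqF // subr_ge0 p1 /= gerBl; exact: ltW.
Qed.

Lemma ler_nat_bool (R : realType) (b c : bool) : (b -> c) -> b%:R <= c%:R :> R.
Proof. by rewrite ler_nat; case: b c => [] [] // ->. Qed.

(** * Fragments of a spread family *)

Definition miss (R : realType) (E I : finType) (J : {set I})
    (S : I -> {set E}) (W : {set E}) : R :=
  (~~ [exists a in J, S a \subset W])%:R.

Lemma miss_decreasing (R : realType) (E I : finType) (J : {set I})
    (S : I -> {set E}) : decreasing (@miss R E I J S).
Proof.
move=> A B AB; apply: ler_nat_bool; apply: contra => /exists_inP[a aJ aA].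
by apply/exists_inP; exists a => //; apply: fintype.subset_trans AB.
Qed.

(** The index [a] is also the default of the minimum; it is itself a candidate when [a \in J], so
    the minimum is then attained by a genuine member. *)
Definition fragment (E I : finType) (J : {set I}) (S : I -> {set E})
    (W : {set E}) (a : I) : {set E} :=
  (S [arg min_(b < a | (b \in J) && (S b \subset W :|: S a)) #|S b :\: W|]%N
     :\: W)%SET.

Lemma fragmentP (E I : finType) (J : {set I}) (S : I -> {set E})
    (W : {set E}) (a : I) : a \in J ->
  exists2 b, b \in J & [/\ fragment J S W a = (S b :\: W)%SET,
    S b \subset (W :|: S a)%SET &
    forall c, c \in J -> S c \subset (W :|: S a)%SET ->
      (#|fragment J S W a| <= #|S c :\: W|)%N].
Proof.
move=> aJ; rewrite /fragment; case: arg_minnP => [|b /andP[bJ bWa] bmin].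
  by rewrite aJ finset.subsetUr.
by exists b => //; split=> // c cJ cWa; apply: bmin; rewrite cJ.
Qed.

Lemma fragment_sub (E I : finType) (J : {set I}) (S : I -> {set E})
    (W : {set E}) (a : I) : a \in J -> fragment J S W a \subset S a.
Proof.
move=> /(fragmentP S W)[b bJ [-> bWa _]]; rewrite finset.subDset //.
Qed.

(** A fragment is disjoint from [W], so [W] can be recovered from the fragment and its union with
    [W]. *)
Lemma fragmentD (E I : finType) (J : {set I}) (S : I -> {set E})
    (W : {set E}) (a : I) :
  ((W :|: fragment J S W a) :\: fragment J S W a)%SET = W.
Proof.
rewrite /fragment; set T := (S _); apply/finset.setP => x; rewrite !inE.
by case: (x \in W); case: (x \in T).
Qed.

(* The fragment can be read off from its union with W, up to the choice of a
   subset of one member of the family. *)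
Lemma fragment_sub_of (E I : finType) (J : {set I}) (S : I -> {set E})
    (W : {set E}) (a b : I) : a \in J -> b \in J ->
  S b \subset (W :|: fragment J S W a)%SET -> fragment J S W a \subset S b.
Proof.
move=> aJ bJ bW; have [c cJ [fE cWa cmin]] := fragmentP S W aJ.
have bWa : S b \subset (W :|: S a)%SET.
  by apply: fintype.subset_trans bW _; rewrite finset.setUS // fragment_sub.
(* [S b :\: W] lies inside the fragment and, by minimality, is no smaller, so the two coincide. *)
have /eqP <- : (S b :\: W)%SET == fragment J S W a.
  by rewrite eqEcard cmin // andbT finset.subDset.
exact: finset.subsetDl.
Qed.

(** For [M = #|J|] this is the usual [kappa]-spread condition; in general the empty [U] gives
    [#|J| <= M]. *)
Definition spread (R : realType) (E I : finType) (M kappa : R) (J : {set I})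
    (S : I -> {set E}) : Prop :=
  forall U : {set E},
    #|[set a in J | U \subset S a]%SET|%:R <= M * kappa^-1 ^+ #|U|.

(** Double counting over [Z], the union of [W] with a fragment [T]. Passing from [W] to [Z] costs
    [p^-1 ^+ #|T|], spreadness leaves at most [M * kappa^-1 ^+ #|T|] indices, and [T] ranges over
    subsets of one member contained in [Z]. The weights of the [Z] sum to 1. *)
Lemma sum_large_fragments (R : realType) (E I : finType) (M kappa p delta : R)
    (J : {set I}) (S : I -> {set E}) (s r : nat) :
  0 <= M -> 0 < kappa -> 0 < p <= 1 -> spread M kappa J S ->
  (forall a, a \in J -> #|S a| <= r)%N ->
  (forall c : {set E}, (#|c| <= r)%N ->
     \sum_(T : {set E} | (T \subset c) && (s < #|T|)%N) (p * kappa)^-1 ^+ #|T|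
       <= delta) ->
  \sum_(W : {set E}) bern_weight p W *
    #|[set a in J | (s < #|fragment J S W a|)%N]%SET|%:R <= M * delta.
Proof.
move=> M0 k0 /[dup] p01 /andP[p0 p1] spS Sr hd.
have p01' : 0 <= p <= 1 by rewrite ltW.
(* An arbitrary member inside [Z]. The empty default is never met for [Z] of the form
   [W :|: fragment J S W a] with [a \in J]. *)
pose c (Z : {set E}) : {set E} :=
  if [pick b in J | S b \subset Z] is Some b then S b else finset.set0.
have cr Z : (#|c Z| <= r)%N.
  by rewrite /c; case: pickP => [b /andP[bJ _]|_]; rewrite ?Sr ?cards0.
have -> : \sum_(W : {set E}) bern_weight p W *
      #|[set a in J | (s < #|fragment J S W a|)%N]%SET|%:R =
    \sum_(u : {set E} * I | (u.2 \in J) && (s < #|fragment J S u.1 u.2|)%N)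
       bern_weight p u.1.
  rewrite (eq_bigr (fun W => \sum_(a | (a \in J) && (s < #|fragment J S W a|)%N)
     bern_weight p W)); last first.
    move=> W _; rewrite sumr_const mulr_natr; congr (_ *+ _).
    by apply: eq_card => a; rewrite inE.
  by rewrite pair_big_dep.
pose phi (u : {set E} * I) : {set E} * {set E} :=
  ((u.1 :|: fragment J S u.1 u.2)%SET, fragment J S u.1 u.2).
pose Q (v : {set E} * {set E}) :=
  (v.2 \subset v.1) && ((v.2 \subset c v.1) && (s < #|v.2|)%N).
rewrite (partition_big phi Q) => [|[W a] /= /andP[aJ sf]]; last first.
  rewrite /Q /= finset.subsetUr sf andbT /c; case: pickP => [b /andP[bJ bW]|].
    exact: fragment_sub_of.
  have [b bJ [fE _ _]] := fragmentP S W aJ.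
  move=> /(_ b); rewrite bJ /= fE => /negP[].
  by rewrite -finset.subDset.
apply: (@le_trans _ _ (\sum_(v | Q v) bern_weight p v.1 *
   (M * (p * kappa)^-1 ^+ #|v.2|))).
  apply: ler_sum => -[Z T] /= /andP[TZ /andP[Tc sT]].
  rewrite (eq_bigr (fun=> bern_weight p (Z :\: T)%SET)); last first.
    by move=> [W a] /= /andP[_ /eqP[<- <-]]; rewrite fragmentD.
  rewrite sumr_const -mulr_natr.
  apply: le_trans (_ : bern_weight p Z * p^-1 ^+ #|T| * (M * kappa^-1 ^+ #|T|) <= _).
    apply: ler_pM; rewrite ?bern_weight_ge0 ?bern_weightD //.
    apply: le_trans (spS T); rewrite ler_nat.
    (* With [Z] and [T] fixed, [W] must be [Z :\: T], so the fibre is counted by its indices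
       alone. *)
    rewrite -(@card_in_imset _ _ snd); last first.
      move=> [W a] [W' a']; rewrite !unfold_in /=.
      move=> /andP[_ /eqP[ZE TE]] /andP[_ /eqP[ZE' TE']] aa'.
      by congr (_, _) => //; rewrite -(fragmentD J S W a) -(fragmentD J S W' a')
        ZE TE ZE' TE'.
    apply: subset_leq_card; apply/fintype.subsetP => y /imsetP[[W a] + ->].
    rewrite unfold_in /= => /andP[/andP[aJ _] /eqP[_ TE]]; rewrite inE aJ /= -TE.
    exact: fragment_sub.
  by rewrite invfM exprMn; rewrite le_eqVlt; apply/orP; left; apply/eqP; ring.
rewrite (eq_bigl (fun v => predT v.1 && Q v)) //.
rewrite -(pair_big_dep predT (fun Z T => Q (Z, T))
  (fun Z T => bern_weight p Z * (M * (p * kappa)^-1 ^+ #|T|))) /=.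
apply: (@le_trans _ _ (\sum_(Z : {set E}) bern_weight p Z * (M * delta))).
  apply: ler_sum => Z _; rewrite -big_distrr /=.
  apply: ler_wpM2l; first exact: bern_weight_ge0.
  rewrite -big_distrr /=; apply: ler_wpM2l => //.
  apply: le_trans (hd _ (cr Z)); rewrite [X in _ <= X](bigID (fun T : {set E} => T \subset Z)) /=.
  rewrite (eq_bigl (fun T : {set E} => ((T \subset c Z) && (s < #|T|)%N) && (T \subset Z)));
    last by move=> T; rewrite /Q /= andbC.
  rewrite lerDl; apply: sumr_ge0 => T _; rewrite exprn_ge0 // invr_ge0.
  by rewrite mulr_ge0 // ltW.
by rewrite -big_distrl /= sum_bern_weight mul1r.
Qed.

(** * Hitting a spread family in rounds *)

Lemma sprinkle_shift (R : realType) (E : finType) (p : R) (s : seq E)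
    (F : {set E} -> R) (W : {set E}) :
  sprinkle p s F W = sprinkle p s (fun V => F (W :|: V)%SET) finset.set0.
Proof.
rewrite -[in LHS](finset.setU0 W).
elim: s finset.set0 => //= e s IH V.
rewrite -/(sprinkle p s F) -/(sprinkle p s (fun V => F (W :|: V)%SET)) /sprinkle1.
by rewrite -IH -IH finset.setUCA.
Qed.

(* A random set of density q misses every member of a kappa-spread family of
   sets of size at most r with probability at most M * eps / #|J|.  The total
   mass M need not be #|J|, since the members with a large fragment are
   discarded in each round. *)
Definition hitting (R : realType) (E I : finType) (kappa : R) (r : nat)
    (q eps : R) : Prop :=
  forall (J : {set I}) (S : I -> {set E}) (M : R), 0 <= M ->
    spread M kappa J S -> (forall a, a \in J -> #|S a| <= r)%N ->
    #|J|%:R * sprinkle q (enum E) (miss R J S) finset.set0 <= M * eps.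

Lemma sprinkle_bounds (R : realType) (E : finType) (p : R) (s : seq E)
    (F : {set E} -> R) (W : {set E}) :
  0 <= p <= 1 -> (forall V, 0 <= F V <= 1) -> 0 <= sprinkle p s F W <= 1.
Proof.
move=> /andP[p0 p1] F01; elim: s W => //= e s IH W.
rewrite -/(sprinkle p s F) /sprinkle1.
have /andP[a0 a1] := IH W; have /andP[b0 b1] := IH (e |: W)%SET.
apply/andP; split; first by rewrite addr_ge0 ?mulr_ge0 // subr_ge0.
nra.
Qed.

(** Expose [W] with density [p]. Members with a fragment larger than [s] are discarded at total cost
    [M * delta]. The other fragments, being subsets of the original members, are spread with the
    same [M], and covering one of them in the second round completes some [S b]. *)
Lemma hitting_step (R : realType) (E I : finType) (kappa : R) (s r : nat)
    (p q q' eps delta : R) :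
  0 < kappa -> 0 < p -> 0 <= q -> p + q <= q' -> q' <= 1 ->
  (forall c : {set E}, (#|c| <= r)%N ->
     \sum_(T : {set E} | (T \subset c) && (s < #|T|)%N) (p * kappa)^-1 ^+ #|T|
       <= delta) ->
  hitting E I kappa s q eps -> hitting E I kappa r q' (delta + eps).
Proof.
move=> k0 p0 q0 pq q'1 hd H J S M M0 spS Sr.
have p01 : 0 < p <= 1 by apply/andP; split => //; lra.
have p01' : 0 <= p <= 1 by rewrite ltW //; case/andP: p01.
have q01 : 0 <= q <= 1 by apply/andP; split => //; lra.
pose G W := sprinkle q (enum E) (miss R J S) W.
apply: (@le_trans _ _ (#|J|%:R * sprinkle p (enum E) G finset.set0)).
  apply: ler_wpM2l => //; apply: sprinkle_thin => //; first exact: ltW.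
  exact: miss_decreasing.
rewrite sprinkleE big_distrr /=.
pose B W := [set a in J | (s < #|fragment J S W a|)%N]%SET.
apply: (@le_trans _ _ (\sum_(W : {set E}) (bern_weight p W * #|B W|%:R +
    bern_weight p W * (M * eps)))); last first.
  rewrite big_split /= -[X in _ + X]big_distrl /= sum_bern_weight mul1r mulrDr.
  by rewrite lerD2r; apply: (sum_large_fragments M0 k0 p01 spS Sr hd).
apply: ler_sum => W _; rewrite mulrCA -mulrDr.
apply: ler_wpM2l; first exact: bern_weight_ge0.
rewrite finset.set0U -(finset.cardsID (B W) J) natrD mulrDl.
have /andP[G0 G1] : 0 <= G W <= 1.
  by apply: sprinkle_bounds => // V; rewrite /miss ler0n lern1 leq_b1.
apply: lerD.
  (* For the discarded members the probability of a miss is merely bounded by 1. *)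
  apply: le_trans (_ : #|J :&: B W|%:R * 1 <= _); first exact: ler_wpM2l.
  by rewrite mulr1 ler_nat subset_leq_card // finset.subsetIr.
apply: le_trans (H (J :\: B W)%SET (fragment J S W) M M0 _ _).
- apply: ler_wpM2l => //; rewrite /G sprinkle_shift; apply: sprinkle_le => // V.
  apply: ler_nat_bool; apply: contra.
  move=> /exists_inP[a]; rewrite inE => /andP[_ aJ] aV.
  have [b bJ [fE _ _]] := fragmentP S W aJ.
  apply/exists_inP; exists b => //; rewrite -finset.subDset -fE //.
- move=> U; apply: le_trans (spS U); rewrite ler_nat subset_leq_card //.
  apply/fintype.subsetP => a; rewrite !inE => /andP[/andP[_ aJ] Ua]; rewrite aJ.
  exact: fintype.subset_trans Ua (fragment_sub _ _ aJ).
- by move=> a; rewrite !inE negb_and -leqNgt => /andP[/orP[/negbTE->|]].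
Qed.

(** The binomial theorem, summed over subsets instead of sizes. *)
Lemma sum_subset_expr (R : realType) (E : finType) (x : R) (c : {set E}) :
  \sum_(T : {set E} | T \subset c) x ^+ #|T| = (1 + x) ^+ #|c|.
Proof.
move: {2}#|c| (erefl #|c|) => n; elim: n c => [|n IH] c cn.
  rewrite (cards0_eq cn) (big_pred1 finset.set0) ?cards0 ?expr0 // => W.
  by rewrite /= -finset.subset0.
have [e ec] : exists e, e \in c by apply/card_gt0P; rewrite cn.
have {}IH : \sum_(T : {set E} | T \subset (c :\ e)%SET) x ^+ #|T| = (1 + x) ^+ #|(c :\ e)%SET|.
  by apply: IH; move: cn; rewrite (finset.cardsD1 e) ec => -[].
rewrite -(finset.setD1K ec); move: (c :\ e)%SET (finset.setD11 e c) IH => {ec cn}c /negbT ec IH.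
rewrite sum_subsetU1 // cardsU1 ec add1n exprS mulrDl mul1r addrC -IH.
congr (_ + _); rewrite big_distrr /=; apply: eq_bigr => W Wc.
rewrite cardsU1 (_ : e \notin W) ?exprS //.
by apply: contra ec => /(fintype.subsetP Wc).
Qed.

Lemma sum_nonempty_subset_le (R : realType) (E : finType) (x : R)
    (c : {set E}) (r : nat) : 0 <= x -> (#|c| <= r)%N ->
  \sum_(T : {set E} | (T \subset c) && (0 < #|T|)%N) x ^+ #|T| <=
    (1 + x) ^+ r - 1.
Proof.
move=> x0 cr; apply: (@le_trans _ _ ((1 + x) ^+ #|c| - 1)).
  rewrite -sum_subset_expr [X in _ <= X - 1](bigD1 finset.set0) ?finset.sub0set //= cards0 expr0.
  rewrite addrC addrK le_eqVlt; apply/orP; left; apply/eqP.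
  by apply: eq_bigl => T; rewrite card_gt0.
by rewrite lerD2r ler_weXn2l // lerDl.
Qed.

(** There are at most [4 ^ s] subsets, and each one with more than [s] elements contributes at most
    [x ^+ s]. *)
Lemma sum_half_subset_le (R : realType) (E : finType) (x : R)
    (c : {set E}) (s : nat) : 0 <= x <= 1 -> (#|c| <= s.*2)%N ->
  \sum_(T : {set E} | (T \subset c) && (s < #|T|)%N) x ^+ #|T| <= (4 * x) ^+ s.
Proof.
move=> /andP[x0 x1] cs.
apply: (@le_trans _ _ (\sum_(T : {set E} | T \subset c) x ^+ s)).
  rewrite [X in _ <= X](bigID (fun T : {set E} => s < #|T|)%N) /=.
  apply: ler_wpDr; first by apply: sumr_ge0 => T _; rewrite exprn_ge0.
  apply: ler_sum => T /andP[_ /ltnW sT].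
  by apply: ler_wiXn2l.
rewrite sumr_const exprMn -[X in X <= _]mulr_natl; apply: ler_wpM2r; first exact: exprn_ge0.
rewrite -natrX ler_nat (_ : 4 = 2 ^ 2)%N // -expnM mul2n.
apply: (@leq_trans (2 ^ #|c|)); last by rewrite leq_pexp2l.
rewrite -card_powerset; apply: subset_leq_card; apply/fintype.subsetP => T.
by rewrite unfold_in finset.powersetE.
Qed.

Lemma sprinkle0 (R : realType) (E : finType) (s : seq E) (F : {set E} -> R) :
  sprinkle 0 s F = F.
Proof.
elim: s => //= e s IH; apply/funext => W.
by rewrite -/(sprinkle 0 s F) IH /sprinkle1 mul0r add0r subr0 mul1r.
Qed.

Lemma hitting_mono (R : realType) (E I : finType) (kappa : R) (r r' : nat)
    (q q' eps eps' : R) :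
  0 <= q -> q <= q' -> q' <= 1 -> eps <= eps' -> (r' <= r)%N ->
  hitting E I kappa r q eps -> hitting E I kappa r' q' eps'.
Proof.
move=> q0 qq' q'1 ee rr H J S M M0 spS Sr.
have {}H := H J S M M0 spS (fun a aJ => leq_trans (Sr a aJ) rr).
apply: (@le_trans _ _ (M * eps)); last exact: ler_wpM2l.
apply: le_trans H; apply: ler_wpM2l => //.
have := @sprinkle_thin R E q 0 q' (enum E) _ q0 (lexx _) _ q'1
  (@miss_decreasing R E I J S).
by rewrite addr0 sprinkle0; apply.
Qed.

(** A member of size 0 is the empty set, which is never missed; without members the left side
    vanishes. *)
Lemma hitting0 (R : realType) (E I : finType) (kappa : R) :
  hitting E I kappa 0 0 0.
Proof.
move=> J S M M0 _ Sr; rewrite mulr0 sprinkle0 /miss.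
have [->|[a aJ]] := finset.set_0Vmem J; first by rewrite cards0 mul0r.
rewrite (_ : [exists b in J, _]) ?mulr0 //; apply/exists_inP; exists a => //.
by rewrite finset.subset0 -cards_eq0 -leqn0 Sr.
Qed.

(** One round of density [L / kappa] with [s = 0] in [hitting_step]: every nonempty fragment counts
    as large, so the remaining ones are already covered. *)
Lemma hitting_start (R : realType) (E I : finType) (kappa : R) (L s : nat) :
  0 < kappa -> (0 < L)%N -> L%:R / kappa <= 1 ->
  hitting E I kappa s (L%:R / kappa) ((1 + L%:R^-1) ^+ s - 1).
Proof.
move=> k0 L0 Lk; have L0' : 0 < L%:R :> R by rewrite ltr0n.
rewrite -[X in hitting _ _ _ _ _ X]addr0.
apply: (@hitting_step _ _ _ _ 0 _ (L%:R / kappa) 0) => //.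
- by rewrite divr_gt0.
- by rewrite addr0.
- move=> c cs; rewrite mulfVK ?gt_eqF //.
  by apply: sum_nonempty_subset_le => //; rewrite invr_ge0 ler0n.
- exact: hitting0.
Qed.

(** Density [8 / kappa] gives ratio [1 / 8] in the sum over fragments, and [4 / 8 = 1 / 2] is the
    base of the error term. *)
Lemma hitting_double (R : realType) (E I : finType) (kappa : R) (s : nat)
    (q eps : R) :
  0 < kappa -> 0 <= q -> 8 / kappa + q <= 1 -> hitting E I kappa s q eps ->
  hitting E I kappa s.*2 (8 / kappa + q) (2^-1 ^+ s + eps).
Proof.
move=> k0 q0 q1; apply: (@hitting_step _ _ _ _ s _ (8 / kappa) q) => //.
  by rewrite divr_gt0.
move=> c cs; rewrite mulfVK ?gt_eqF //.
apply: le_trans (sum_half_subset_le _ cs) _; first by apply/andP; split; lra.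
by rewrite (_ : 4 * 8^-1 = 2^-1 :> R) //; field.
Qed.

Lemma hitting_rounds (R : realType) (E I : finType) (kappa : R) (L s j : nat) :
  0 < kappa -> (0 < L)%N -> (L + 8 * j)%:R / kappa <= 1 ->
  hitting E I kappa (2 ^ j * s) ((L + 8 * j)%:R / kappa)
    ((1 + L%:R^-1) ^+ s - 1 + j%:R * 2^-1 ^+ s).
Proof.
move=> k0 L0; elim: j => [|j IH] Lk.
  by rewrite muln0 addn0 mul1n mul0r addr0; apply: hitting_start; rewrite // muln0 addn0 in Lk.
have qE : (L + 8 * j.+1)%:R / kappa = 8 / kappa + (L + 8 * j)%:R / kappa.
  by rewrite -mulrDl -natrD mulnS addnCA.
have q0 : 0 <= (L + 8 * j)%:R / kappa by rewrite divr_ge0 // ltW.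
rewrite qE expnS -mulnA mul2n in Lk *.
have k8 : 0 <= 8 / kappa by rewrite divr_ge0 // ltW.
have {}IH := IH (le_trans _ Lk); rewrite lerDr in IH.
apply: hitting_mono (hitting_double k0 q0 Lk (IH k8)) => //.
- by rewrite addr_ge0 // divr_ge0 // ltW.
- set A := _ ^+ s - 1; rewrite -(natr1 j) mulrDl mul1r addrC addrA lerD2l.
  apply: ler_wiXn2l; rewrite ?invr_ge0 // ?invf_le1 ?ler1n //.
  by rewrite leq_pmull // expn_gt0.
Qed.

(** With [y = n * x], the power is at most [expR y <= (1 - y)^-1], and this is at most [1 + 2 * y]
    as long as [y <= 1 / 2]. *)
Lemma expr1D_le (R : realType) (x : R) (n : nat) :
  0 <= x -> n%:R * x <= 2^-1 -> (1 + x) ^+ n - 1 <= 2 * (n%:R * x).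
Proof.
move=> x0 nx; set y := n%:R * x in nx *.
have y0 : 0 <= y by rewrite mulr_ge0.
have : (1 + x) ^+ n <= (1 - y)^-1.
  apply: (@le_trans _ _ (expR y)).
    by rewrite /y expRM_natl; apply: lerXn2r; rewrite ?nnegrE ?expR_ge0 ?expR_ge1Dx // addr_ge0.
  rewrite -[y]opprK expRN lef_pV2 ?posrE ?expR_gt0 ?opprK //; last lra.
  exact: expR_ge1Dx.
move=> H; rewrite lerBlDr; apply: le_trans H _.
by rewrite -[X in X <= _]mul1r ler_pdivrMr; [nra|lra].
Qed.

Lemma sqr_le_exp2 (s : nat) : (s.+1 ^ 2 <= 4 * 2 ^ s)%N.
Proof.
elim: s => // -[|[|s]] IH //; rewrite [(2 ^ _.+3)%N]expnS mulnCA.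
apply: (@leq_trans (2 * s.+3 ^ 2)); last by rewrite leq_mul2l IH.
by rewrite -!mulnn; nia.
Qed.

(* The threshold [9 * L / kappa] is the sum of the densities of [L] halving
   rounds ([8 / kappa] each) and of one last round, which starts from
   fragments of size [L %/ m]. *)
Lemma hitting_threshold (R : realType) (eps : R) : 0 < eps ->
  exists L0 : nat, forall (L : nat) (E I : finType) (kappa q : R) (r : nat),
    (L0 <= L)%N -> 0 < kappa -> (r <= 2 ^ L)%N ->
    (9 * L)%:R / kappa <= q -> q <= 1 -> hitting E I kappa r q eps.
Proof.
(* The last round fails with probability at most [2 * s / L <= 2 / m], and [m >= 4 / eps] turns this
   into [eps / 2]. The two successors ensure [m >= 2], so that [expr1D_le] applies. *)
move=> e0; pose m := (Num.bound (4 / eps)).+2.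
have m0 : 0 < m%:R :> R by rewrite ltr0n.
have me : 4 / eps <= m%:R.
  apply: ltW; apply: lt_trans (archi_boundP _) _; last by rewrite ltr_nat; lia.
  by rewrite divr_ge0 // ltW.
(* The first term makes [s = L %/ m] positive. The second makes the halving rounds fail with
   probability at most [eps / 2]: from [L <= s.+1 * m] and [s.+1 ^ 2 <= 4 * 2 ^ s] follows
   [L ^ 2 <= L * 2 ^ s * eps / 2]. *)
exists (m + Num.bound (8 * m%:R ^+ 2 / eps))%N => L E I kappa q r LL k0 rL Lq q1.
have L0 : (0 < L)%N by lia.
have L0' : 0 < L%:R :> R by rewrite ltr0n.
have Lm : 8 * m%:R ^+ 2 / eps <= L%:R :> R.
  apply: ltW; apply: lt_le_trans (archi_boundP _) _; last by rewrite ler_nat; lia.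
  by rewrite divr_ge0 ?mulr_ge0 ?exprn_ge0 // ltW.
pose s := (L %/ m)%N.
have s0 : (0 < s)%N by rewrite divn_gt0 //; lia.
have sL : (s * m <= L)%N by exact: leq_trunc_div.
have Ls : (L < s.+1 * m)%N by rewrite ltn_ceil.
have LqE : (L + 8 * L)%:R / kappa = (9 * L)%:R / kappa :> R by rewrite -mulSn.
apply: (@hitting_mono _ _ _ _ (2 ^ L * s) _ ((L + 8 * L)%:R / kappa)
   _ ((1 + L%:R^-1) ^+ s - 1 + L%:R * 2^-1 ^+ s)) => //.
- by rewrite divr_ge0 // ltW.
- have sLm : s%:R * L%:R^-1 <= m%:R^-1 :> R.
    by rewrite ler_pdivrMr // mulrC ler_pdivlMr // -natrM ler_nat.
  have m2 : m%:R^-1 <= 2^-1 :> R by rewrite lef_pV2 ?posrE // ler_nat.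
  have me' : m%:R^-1 <= eps / 4.
    by rewrite -[eps / 4]invrK lef_pV2 ?posrE ?invr_gt0 ?divr_gt0 // invf_div.
  have A : (1 + L%:R^-1) ^+ s - 1 <= eps / 2 :> R.
    apply: le_trans (expr1D_le _ _) _; rewrite ?invr_ge0 //.
      exact: le_trans sLm m2.
    by have := le_trans sLm me'; lra.
  suff B : L%:R * 2^-1 ^+ s <= eps / 2 :> R by lra.
  rewrite exprVn ler_pdivrMr ?exprn_gt0 //.
  have H1 : s.+1%:R ^+ 2 <= 4 * 2 ^+ s :> R.
    by rewrite -!natrX -natrM ler_nat sqr_le_exp2.
  have H2 : L%:R <= s.+1%:R * m%:R :> R by rewrite -natrM ler_nat ltnW.
  have H3 : 8 * m%:R ^+ 2 <= eps * L%:R.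
    by move: Lm; rewrite ler_pdivrMr // [L%:R * _]mulrC.
  set X := 2 ^+ s in H1 *; set y := L%:R in H2 H3 L0' *.
  set z := s.+1%:R in H1 H2; set mm := m%:R in H2 H3 m0.
  have z0 : 0 <= z by rewrite ler0n.
  have H4 : y ^+ 2 <= z ^+ 2 * mm ^+ 2.
    by rewrite -exprMn; apply: lerXn2r; rewrite ?nnegrE ?mulr_ge0 // ltW.
  have H5 : z ^+ 2 * mm ^+ 2 <= (4 * X) * (eps * y / 8).
    apply: ler_pM; rewrite ?exprn_ge0 // ?(ltW m0) //.
    by rewrite ler_pdivlMr // mulrC.
  have H6 : y * y <= y * (eps / 2 * X) by rewrite -expr2; lra.
  by rewrite ler_pM2l in H6.
- by rewrite (leq_trans rL) // leq_pmulr.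
- by rewrite LqE; apply: hitting_rounds => //; rewrite ?LqE // (le_trans Lq).
Qed.

(** * The replacement argument for edge colours *)

Definition update (E T : finType) (g : {ffun E -> T}) (e : E) (t : T) :
    {ffun E -> T} :=
  [ffun x => if x == e then t else g x].

Definition resample1 (R : realType) (E T : finType) (w : T -> R) (e : E)
    (F : {ffun E -> T} -> R) (g : {ffun E -> T}) : R :=
  \sum_t w t * F (update g e t).

Definition resample (R : realType) (E T : finType) (w : T -> R) (s : seq E)
    (F : {ffun E -> T} -> R) : {ffun E -> T} -> R :=
  foldr (resample1 w) F s.

Lemma updateC (E T : finType) (g : {ffun E -> T}) (e e' : E) (t t' : T) :
  e != e' -> update (update g e t) e' t' = update (update g e' t') e t.
Proof.
move=> ee'; apply/ffunP => x; rewrite !ffunE.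
by case: (eqVneq x e') => // ->; rewrite eq_sym (negbTE ee').
Qed.

Lemma resample_op (R : realType) (E T : finType) (w : T -> R) (s : seq E)
    (e : E) (F : {ffun E -> T} -> R) : e \notin s ->
  resample w s (resample1 w e F) = resample1 w e (resample w s F).
Proof.
elim: s => //= e' s IH; rewrite inE negb_or => /andP[ee' es].
rewrite -/(resample w s F) -/(resample w s (resample1 w e F)) IH //.
apply/funext => g; rewrite /resample1.
under eq_bigr do rewrite big_distrr.
rewrite exchange_big /=; apply: eq_bigr => t _; rewrite big_distrr /=.
by apply: eq_bigr => t' _; rewrite mulrCA updateC // eq_sym.
Qed.

(** Redrawing the coordinates in [s] leaves the others alone, so the comparison is needed only for
    colourings that agree with [g] off [s]. *)
Lemma resample_le (R : realType) (E T : finType) (w : T -> R) (s : seq E)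
    (F G : {ffun E -> T} -> R) (g : {ffun E -> T}) :
  (forall t, 0 <= w t) ->
  (forall g' : {ffun E -> T}, (forall e, e \notin s -> g' e = g e) -> F g' <= G g') ->
  resample w s F g <= resample w s G g.
Proof.
move=> w0; elim: s g => [|e s IH] g FG /=; first exact: FG.
rewrite -/(resample w s F) -/(resample w s G).
apply: ler_sum => t _; apply: ler_wpM2l => //; apply: IH => g' gg'.
apply: FG => x; rewrite inE negb_or => /andP[xe xs].
by rewrite gg' // ffunE (negbTE xe).
Qed.

Lemma resample_linear (R : realType) (E T : finType) (w : T -> R) (s : seq E)
    (a b : R) (F G : {ffun E -> T} -> R) (g : {ffun E -> T}) :
  resample w s (fun h => a * F h + b * G h) g =
  a * resample w s F g + b * resample w s G g.
Proof.
elim: s g => //= e s IH g.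
rewrite -/(resample w s F) -/(resample w s G) -/(resample w s _) /resample1.
rewrite !big_distrr /= -big_split /=; apply: eq_bigr => t _.
by rewrite -/(resample w s (fun h => a * F h + b * G h)) IH; ring.
Qed.

Lemma resampleE (R : realType) (E T : finType) (w : T -> R)
    (F : {ffun E -> T} -> R) (g : {ffun E -> T}) :
  resample w (enum E) F g = \sum_(h : {ffun E -> T}) (\prod_e w (h e)) * F h.
Proof.
suff H : forall (s : seq E) g, uniq s -> resample w s F g =
    \sum_(h : {ffun E -> T} | [forall x, (x \notin s) ==> (h x == g x)])
      (\prod_(e <- s) w (h e)) * F h.
  rewrite H ?enum_uniq //; apply: eq_big => [h|h _].
    by apply/forallP => x; rewrite mem_enum.
  by rewrite big_enum.
elim=> [|e s IH] {}g /=.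
  rewrite (big_pred1 g) => [_|h /=]; first by rewrite big_nil mul1r.
  apply/forallP/eqP => [H|-> x] /=; last by rewrite eqxx.
  by apply/ffunP => x; apply/eqP; exact: H.
case/andP => es us; rewrite -/(resample w s F) /resample1.
rewrite (partition_big (fun h : {ffun E -> T} => h e) predT) //=.
apply: eq_bigr => t _; rewrite IH // big_distrr /=.
apply: eq_big => [h|h /forallP/(_ e)].
  apply/forallP/andP => [H|[/forallP H /eqP ht] x].
    split; last by have := H e; rewrite es ffunE eqxx.
    apply/forallP => x; apply/implyP; rewrite inE negb_or => /andP[xe xs].
    by have := H x; rewrite xs ffunE (negbTE xe).
  apply/implyP => xs; rewrite ffunE; case: (eqVneq x e) => [->|xe]; first by rewrite ht.
  by have := H x; rewrite inE negb_or xe xs.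
by rewrite es ffunE eqxx /= => /eqP <-; rewrite big_cons mulrA.
Qed.

(** Interpolates between two models: for empty [W] only the colours given by [g] count, and for [g]
    constantly [None] it is [miss]. *)
Definition coloured_miss (R : realType) (E I C : finType) (J : {set I})
    (S : I -> {set E}) (phi : I -> E -> C) (W : {set E})
    (g : {ffun E -> option C}) : R :=
  (~~ [exists a in J, [forall e in S a,
         (e \in W) || (g e == Some (phi a e))]])%:R.

(* McDiarmid's replacement argument: an element of W is available in every
   colour, and turning it into an element with a single random colour can only
   help as long as each colour keeps probability at least q, because one
   suitable colour at e is enough. *)
Lemma coloured_miss_replace (R : realType) (E I C : finType) (J : {set I})
    (S : I -> {set E}) (phi : I -> E -> C) (w : option C -> R) (q : R)
    (W : {set E}) (e : E) (g : {ffun E -> option C}) :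
  (forall t, 0 <= w t) -> \sum_t w t = 1 -> 0 <= q ->
  (forall i, q <= w (Some i)) -> g e = None ->
  resample1 w e (coloured_miss R J S phi W) g <=
    q * coloured_miss R J S phi (e |: W)%SET g +
    (1 - q) * coloured_miss R J S phi W g.
Proof.
move=> w0 w1 q0 qw ge; rewrite /resample1 /coloured_miss.
(* Since [g e = None], no member relied on the colour of [e], so giving [e] a colour destroys
   nothing. *)
have mono t : (~~ [exists a in J, [forall x in S a,
         (x \in W) || (update g e t x == Some (phi a x))]])%:R <=
   (~~ [exists a in J, [forall x in S a,
         (x \in W) || (g x == Some (phi a x))]])%:R :> R.
  apply: ler_nat_bool; apply: contra => /exists_inP[a aJ /forall_inP H].
  apply/exists_inP; exists a => //; apply/forall_inP => x xS.
  have /orP[->//|gx] := H x xS; rewrite ffunE.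
  case: (x =P e) => [xe|_]; last by rewrite gx orbT.
  by rewrite xe ge in gx.
have le1 (b : bool) : b%:R <= 1 :> R by rewrite lern1 leq_b1.
set m := ((~~ [exists a in J, [forall x in S a,
         (x \in W) || (g x == Some (phi a x))]])%:R : R) in mono *.
have [m0|m1] : m = 0 \/ m = 1 by rewrite /m; case: (~~ _); [right|left].
  rewrite m0 mulr0 addr0; apply: (@le_trans _ _ 0); last by rewrite mulr_ge0.
  apply: sumr_le0 => t _; rewrite mulr_ge0_le0 //; have := mono t; rewrite m0.
  by [].
rewrite m1 mulr1; case: (boolP [exists a in J, _]) => /=; last first.
  move=> _; rewrite mulr1 addrC subrK -[X in _ <= X]w1; apply: ler_sum => t _.
  by rewrite -[X in _ <= X]mulr1 ler_wpM2l ?le1.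
(* The pivotal case: member [a] lacks at most [e], and the single colour [phi a e], drawn with
   probability at least [q], completes it. *)
move=> /exists_inP[a aJ /forall_inP H].
rewrite mulr0 add0r (bigD1 (Some (phi a e))) //=.
rewrite (_ : [exists b in J, _]) /=; last first.
  apply/exists_inP; exists a => //; apply/forall_inP => x xS.
  have := H x xS; rewrite !inE ffunE; case: (x =P e) => [->|_] //=.
  by rewrite eqxx orbT.
rewrite mulr0 add0r -[X in _ <= X - _]w1 [X in _ <= X - _](bigD1 (Some (phi a e))) //=.
apply: (@le_trans _ _ (\sum_(t | t != Some (phi a e)) w t)).
  by apply: ler_sum => t _; rewrite -[X in _ <= X]mulr1 ler_wpM2l ?le1.
by rewrite addrAC lerDr subr_ge0.
Qed.

Lemma mcdiarmid (R : realType) (E I C : finType) (J : {set I})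
    (S : I -> {set E}) (phi : I -> E -> C) (w : option C -> R) (q : R) :
  (forall t, 0 <= w t) -> \sum_t w t = 1 -> 0 <= q -> q <= 1 ->
  (forall i, q <= w (Some i)) ->
  \sum_(g : {ffun E -> option C}) (\prod_e w (g e)) *
     coloured_miss R J S phi finset.set0 g <=
  sprinkle q (enum E) (miss R J S) finset.set0.
Proof.
move=> w0 w1 q0 q1 qw.
pose g0 : {ffun E -> option C} := [ffun=> None].
rewrite -(resampleE w _ g0).
have -> : miss R J S = (fun W => coloured_miss R J S phi W g0).
  apply/funext => W; rewrite /miss /coloured_miss; congr (~~ _)%:R.
  apply: eq_existsb => a; congr (_ && _); apply/fintype.subsetP/forall_inP => H x xS.
    by rewrite H.
  by have := H x xS; rewrite ffunE orbF.
have : forall e, e \in enum E -> g0 e = None by move=> e _; rewrite ffunE.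
move: (enum_uniq E); elim: (enum E) g0 finset.set0 => //= e s IH g W.
case/andP => es us gN.
(* The redraw of [e] is moved innermost; the redraws in [s] do not touch [e], which therefore still
   carries [None] as the replacement step requires. *)
rewrite -/(resample w s _) -/(sprinkle q s _) -resample_op //.
apply: (@le_trans _ _ (resample w s (fun h =>
   q * coloured_miss R J S phi (e |: W)%SET h +
   (1 - q) * coloured_miss R J S phi W h) g)).
  apply: resample_le => // h hg; apply: coloured_miss_replace => //.
  by rewrite hg // gN // mem_head.
rewrite resample_linear /sprinkle1.
have gs : forall x, x \in s -> g x = None by move=> x xs; rewrite gN // inE xs orbT.
by apply: lerD; apply: ler_wpM2l; rewrite ?subr_ge0 //; apply: IH.
Qed.

(** * Bijections with prescribed vertex colours *)

Definition colour_class (n l : nat) (cv : 'I_n -> 'I_l) (j : 'I_l) : nat :=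
  #|[set v | cv v == j]%SET|.

Definition colour_bijections (n l : nat) (cv c2 : 'I_n -> 'I_l) :
    {set {perm 'I_n}} :=
  [set x : {perm 'I_n} | [forall i, cv (x i) == c2 i]]%SET.

Definition cycle_edges (n : nat) (x : {perm 'I_n}) : {set vpair n} :=
  [set e : vpair n | [exists i, val e == [set x i; x (ordS i)]%SET]]%SET.

Lemma card_pfamily_prod (aT rT : finType) (y0 : rT) (D : {pred aT})
    (F : aT -> pred rT) :
  #|pfamily y0 D F| = (\prod_(x in D) #|F x|)%N.
Proof. by rewrite card_pfamily foldrE big_image. Qed.

(** Vertices are released one at a time. A bijection that fixes the position of [v] yields another
    for each unfixed [w] of the colour of [v], by exchanging [v] and [w]; the number of such [w] is
    the next factor of the falling factorial. *)
Lemma card_colour_bijections_fixed (n l : nat) (cv c2 : 'I_n -> 'I_l)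
    (y : 'I_n -> 'I_n) (B : {set 'I_n}) :
  (#|[set x in colour_bijections cv c2 | [forall v in B, x (y v) == v]]%SET| *
   \prod_j colour_class cv j ^_ #|[set v in B | cv v == j]%SET| <=
   #|colour_bijections cv c2|)%N.
Proof.
move: {2}#|B| (erefl #|B|) => m; elim: m B => [|m IH] B Bm.
  rewrite (cards0_eq Bm) big1 ?muln1 => [|j _].
    by apply: subset_leq_card; apply/fintype.subsetP => x; rewrite inE => /andP[].
  by rewrite (_ : [set v in _ | _]%SET = finset.set0) ?cards0 ?ffactn0 //;
    apply/finset.setP => v; rewrite !inE.
have [v vB] : exists v, v \in B by apply/card_gt0P; rewrite Bm.
have Bv : #|(B :\ v)%SET| = m by move: Bm; rewrite (finset.cardsD1 v) vB => -[].
have {}IH := IH _ Bv.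
rewrite -(finset.setD1K vB); move: (B :\ v)%SET (finset.setD11 v B) IH => {Bm Bv vB}B /negbT vB IH.
pose A := [set w in ~: B | cv w == cv v]%SET.
pose b j := #|[set v in B | cv v == j]%SET|.
pose P := (\prod_j colour_class cv j ^_ b j)%N.
have cardA : #|A| = (colour_class cv (cv v) - b (cv v))%N.
  rewrite /colour_class -(finset.cardsID B [set w | cv w == cv v]%SET).
  rewrite (_ : _ :&: B = [set w in B | cv w == cv v])%SET; last first.
    by apply/finset.setP => w; rewrite !inE andbC.
  by rewrite addKn; apply: eq_card => w; rewrite !inE.
have -> : (\prod_j colour_class cv j ^_ #|[set w in v |: B | cv w == j]%SET|
    = P * #|A|)%N.
  rewrite /P (bigD1 (cv v)) //= [in RHS](bigD1 (cv v)) //= cardA.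
  have -> : #|[set w in v |: B | cv w == cv v]%SET| = (b (cv v)).+1.
    rewrite (_ : [set _ in _ | _]%SET = (v |: [set w in B | cv w == cv v])%SET).
      by rewrite cardsU1 inE (negbTE vB).
    by apply/finset.setP => w; rewrite !inE; case: (w =P v) => [->|//]; rewrite eqxx.
  rewrite ffactnSr mulnAC; congr (_ * _ * _)%N.
  apply: eq_bigr => j jv; congr (_ ^_ _)%N; apply: eq_card => w; rewrite !inE.
  by case: (w =P v) => //= ->; rewrite eq_sym (negbTE jv) andbF.
set X := [set x in _ | _]%SET.
apply: leq_trans IH; rewrite -/P mulnA mulnAC leq_mul2r; apply/orP; right.
rewrite -cardsX.
(* The exchanged bijection has [w] at position [y v]; this reveals [w], and undoing the exchange
   reveals [x]. *)
rewrite -(@card_in_imset _ _ (fun u => u.1 * tperm v u.2)%g); last first.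
  move=> [x w] [x' w']; rewrite !inE /= => /andP[/andP[_ xB] wA].
  move=> /andP[/andP[_ xB'] wA'] E.
  have xv : x (y v) = v by apply/eqP; move/forall_inP: xB; apply; exact: finset.setU11.
  have xv' : x' (y v) = v by apply/eqP; move/forall_inP: xB'; apply; exact: finset.setU11.
  have ww : w = w'.
    by have := congr1 (fun s : {perm _} => s (y v)) E; rewrite !permM xv xv' !tpermL.
  by move: E; rewrite ww => /mulIg ->.
apply: subset_leq_card; apply/fintype.subsetP => _ /imsetP[[x w] + ->].
rewrite !inE /= => /andP[/andP[/forallP xc /forall_inP xB] /andP[wB /eqP wv]].
apply/andP; split.
  apply/forallP => i; rewrite permM; case: tpermP => [E|E|_ _] //.
    by rewrite wv -E.
  by rewrite -wv -E.
apply/forall_inP => u uB; rewrite permM.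
rewrite (eqP (xB u _)) ?inE ?uB ?orbT // tpermD //.
  by apply: contra vB => /eqP ->.
by apply: contra wB => /eqP ->.
Qed.

(** Each induction step costs one factor [expR 1], because [(1 + 1 / n) ^+ b <= expR 1] for
    [b <= n]. *)
Lemma expn_le_ffact (R : realType) (n b : nat) : (b <= n)%N ->
  n%:R ^+ b <= expR 1 ^+ b * (n ^_ b)%:R :> R.
Proof.
elim: n b => [|n IH] [|b] //; rewrite ?expr0 ?ffactn0 ?mul1r //.
rewrite ltnS => bn; rewrite ffactSS natrM exprS [expR 1 ^+ _]exprS mulrCA.
apply: ler_wpM2l => //; apply: (@le_trans _ _ (expR 1 * n%:R ^+ b)); last first.
  by rewrite -mulrA; apply: ler_wpM2l; rewrite ?expR_ge0 ?IH.
case: n bn {IH} => [|n] bn.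
  by move: bn; rewrite leqn0 => /eqP ->; rewrite !expr0 mulr1; apply: le_trans (expR_ge1Dx 1); rewrite lerDl.
have n0 : 0 < n.+1%:R :> R by rewrite ltr0n.
have -> : n.+2%:R = (1 + n.+1%:R^-1) * n.+1%:R :> R.
  by rewrite mulrDl mul1r mulVf ?gt_eqF // natr1.
rewrite exprMn; apply: ler_wpM2r; first exact: exprn_ge0.
apply: (@le_trans _ _ (expR (n.+1%:R^-1) ^+ b)).
  by apply: lerXn2r; rewrite ?nnegrE ?expR_ge0 ?expR_ge1Dx // addr_ge0 // invr_ge0.
rewrite -expRM_natl ler_expR -[X in _ <= X](@mulfV _ n.+1%:R) ?gt_eqF //.
by apply: ler_wpM2r; rewrite ?invr_ge0 // ler_nat.
Qed.

Lemma colour_bijections_fixed_le (R : realType) (n l : nat)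
    (cv c2 : 'I_n -> 'I_l) (y : 'I_n -> 'I_n) (B : {set 'I_n}) :
  #|[set x in colour_bijections cv c2 | [forall v in B, x (y v) == v]]%SET|%:R *
  \prod_(v in B) (colour_class cv (cv v))%:R <=
  expR 1 ^+ #|B| * #|colour_bijections cv c2|%:R :> R.
Proof.
pose b j := #|[set v in B | cv v == j]%SET|.
have prodE (F : 'I_l -> R) :
    \prod_(v in B) F (cv v) = \prod_j F j ^+ b j.
  rewrite (partition_big cv predT) //=; apply: eq_bigr => j _.
  rewrite (eq_bigr (fun=> F j)) => [|v /andP[_ /eqP->] //].
  by rewrite prodr_const; congr (_ ^+ _); apply: eq_card => v; rewrite !inE.
rewrite (prodE (fun j => (colour_class cv j)%:R)).
have -> : expR 1 ^+ #|B| = \prod_j expR 1 ^+ b j :> R.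
  by rewrite -(prodE (fun=> expR 1)) prodr_const.
apply: (@le_trans _ _ (#|[set x in colour_bijections cv c2 |
     [forall v in B, x (y v) == v]]%SET|%:R *
   (\prod_j expR 1 ^+ b j * \prod_j (colour_class cv j ^_ b j)%:R))).
  apply: ler_wpM2l => //; rewrite -big_split /=; apply: ler_prod => j _.
  rewrite exprn_ge0 //= expn_le_ffact //; apply: subset_leq_card.
  by apply/fintype.subsetP => v; rewrite !inE => /andP[].
rewrite mulrCA; apply: ler_wpM2l.
  by apply: prodr_ge0 => j _; rewrite exprn_ge0 // expR_ge0.
by rewrite -natr_prod -natrM ler_nat card_colour_bijections_fixed.
Qed.

(** * Cycles through a given set of pairs *)

Lemma ord_pred_closed_full (n : nat) (P : {set 'I_n}) (i0 : 'I_n) :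
  i0 \in P -> (forall i, i \in P -> ord_pred i \in P) -> P = [set: 'I_n]%SET.
Proof.
case: n P i0 => [|n] P i0; first by case: i0.
move=> i0P cl.
(* Stepping down leads from [i0] to position 0, then around to the last position, and from there to
   every position. *)
have down : forall m (i : 'I_n.+1), i \in P -> (m <= i)%N -> inord (i - m) \in P.
  elim=> [|m IH] i iP mi; first by rewrite subn0 inord_val.
  have {}IH := cl _ (IH i iP (ltnW mi)).
  suff <- : ord_pred (inord (i - m) : 'I_n.+1) = inord (i - m.+1) by [].
  apply: val_inj => /=; rewrite !inordK; try (have := ltn_ord i; lia).
  have ni := ltn_ord i.
  rewrite (_ : (i - m + n.+1).-1 = i - m.+1 + n.+1)%N; last by lia.
  by rewrite modnDr modn_small //; lia.
have P0 : ord0 \in P.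
  by have := down i0 i0 i0P (leqnn _); rewrite subnn; congr (_ \in P);
    apply: val_inj; rewrite /= inordK.
have Pmax : ord_max \in P.
  have := cl _ P0; congr (_ \in P); apply: val_inj => /=.
  by rewrite modn_small.
apply/finset.setP => i; rewrite inE.
have := down (n - i)%N _ Pmax (leq_subr _ _).
congr (_ \in P); apply: val_inj => /=; have := ltn_ord i => ni.
by rewrite inordK; lia.
Qed.

Definition touched (n : nat) (U : {set vpair n}) : {set 'I_n} :=
  (\bigcup_(e in U) val e)%SET.

Lemma touchedP (n : nat) (U : {set vpair n}) (e : vpair n) (v : 'I_n) :
  e \in U -> v \in val e -> v \in touched U.
Proof. by move=> eU ve; apply/bigcupP; exists e. Qed.

Lemma card_touched (n : nat) (U : {set vpair n}) : (#|touched U| <= 2 * #|U|)%N.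
Proof.
rewrite mulnC -sum_nat_const /touched.
elim/big_ind2: _ => [|A a B b Aa Bb|e _]; first by rewrite cards0.
  by rewrite cardsU; lia.
by rewrite (eqP (valP e)).
Qed.

(* [traverses x U h] : the cycle x runs through every edge of U, entering
   [h e] last when it uses the edge e. *)
Definition traverses (n : nat) (x : {perm 'I_n}) (U : {set vpair n})
    (h : vpair n -> 'I_n) : bool :=
  [forall e in U, [exists i,
    (val e == [set x i; x (ordS i)]%SET) && (x (ordS i) == h e)]].

(* The vertices of the touched paths are located by following the paths from
   their initial vertices.  This could only fail if U closed up to a cycle. *)
Lemma traverses_determined (n : nat) (x x' : {perm 'I_n}) (U : {set vpair n})
    (h : vpair n -> 'I_n) :
  traverses x U h -> traverses x' U h -> (#|U| < n)%N ->
  (forall v, v \in (touched U :\: h @: U)%SET -> (x^-1)%g v = (x'^-1)%g v) ->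
  forall v, v \in touched U -> (x^-1)%g v = (x'^-1)%g v.
Proof.
move=> /forall_inP xU /forall_inP xU' Un agree.
pose Bad := [set v in touched U | (x^-1)%g v != (x'^-1)%g v]%SET.
have BadH v : v \in Bad -> v \in h @: U.
  rewrite inE => /andP[vB vx]; apply: contraNT vx => vh; apply/eqP/agree.
  by rewrite inE vh.
(* A misplaced [v] is the head of an edge of [U], so both cycles visit the other end of that edge
   just before [v]; that end is then misplaced too. *)
have BadP v : v \in Bad -> x (ord_pred ((x^-1)%g v)) \in Bad.
  move=> vBad; have /imsetP[e eU ve] := BadH v vBad.
  have /existsP[i /andP[/eqP ei /eqP hi]] := xU e eU.
  have /existsP[i' /andP[/eqP ei' /eqP hi']] := xU' e eU.
  have xv : (x^-1)%g v = ordS i by rewrite ve -hi permK.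
  have xv' : (x'^-1)%g v = ordS i' by rewrite ve -hi' permK.
  rewrite xv ordSK inE (touchedP eU) ?ei ?set21 //=.
  move: vBad; rewrite inE xv xv' => /andP[_]; apply: contra.
  have c2 := eqP (valP e).
  have wv : x i != v.
    by apply/eqP => E; move: c2; rewrite ei hi -ve E finset.setUid cards1.
  have : x i \in [set x' i'; x' (ordS i')]%SET by rewrite -ei' ei set21.
  rewrite hi' -ve !inE (negbTE wv) orbF => /eqP E.
  by rewrite permK E permK => /eqP ->.
move=> v vB; apply/eqP; apply: contraT => vx.
have vBad : v \in Bad by rewrite inE vB.
(* Going backwards around the cycle makes every vertex misplaced, hence a head, although [U] has
   fewer than [n] heads. *)
have full : [set i | x i \in Bad]%SET = [set: 'I_n]%SET.
  apply: (@ord_pred_closed_full _ _ ((x^-1)%g v)); first by rewrite inE permKV.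
  by move=> i; rewrite inE => /BadP; rewrite permK => H; rewrite inE.
have : (n <= #|h @: U|)%N.
  rewrite -[X in (X <= _)%N]card_ord; apply: subset_leq_card.
  apply/fintype.subsetP => u _; apply: BadH.
  have : (x^-1)%g u \in [set i | x i \in Bad]%SET by rewrite full inE.
  by rewrite inE permKV.
by move=> /leq_trans/(_ (leq_imset_card _ _)); rewrite leqNgt Un.
Qed.

(** Group the cycles by the positions of the initial vertices [Rt]. Each such vertex has as many
    possible positions as its colour class has vertices, and within a group all touched vertices are
    fixed. The product over [Rt] cancels, which leaves the product over the heads. *)
Lemma card_traverses_le (R : realType) (n l : nat) (cv c2 : 'I_n -> 'I_l)
    (U : {set vpair n}) (h : vpair n -> 'I_n) :
  (forall j, colour_class c2 j = colour_class cv j) -> (#|U| < n)%N ->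
  (forall e, e \in U -> h e \in val e) ->
  #|[set x in colour_bijections cv c2 | traverses x U h]%SET|%:R *
  \prod_(v in h @: U) (colour_class cv (cv v))%:R <=
  expR 1 ^+ #|touched U| * #|colour_bijections cv c2|%:R :> R.
Proof.
move=> cc Un hU; have n0 : (0 < n)%N by exact: leq_ltn_trans Un.
pose i0 : 'I_n := Ordinal n0.
pose Rt := (touched U :\: h @: U)%SET.
set X := [set x in _ | _]%SET.
set N := #|colour_bijections cv c2|.
pose loc (x : {perm 'I_n}) : {ffun 'I_n -> 'I_n} :=
  [ffun v => if v \in Rt then (x^-1)%g v else i0].
pose cls v := fun i : 'I_n => c2 i == cv v.
have csE v : #|cls v| = colour_class cv (cv v).
  by rewrite -cc /colour_class cardsE.
have clsgt0 v : 0 < (colour_class cv (cv v))%:R :> R.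
  by rewrite ltr0n; apply/card_gt0P; exists v; rewrite inE.
have fib (g : {ffun 'I_n -> 'I_n}) :
    #|[set x in X | loc x == g]%SET|%:R *
    \prod_(v in touched U) (colour_class cv (cv v))%:R <= expR 1 ^+ #|touched U| * N%:R :> R.
  have [->|[x0]] := finset.set_0Vmem [set x in X | loc x == g]%SET.
    by rewrite cards0 mul0r mulr_ge0 // exprn_ge0 // expR_ge0.
  rewrite !inE => /andP[/andP[x0c x0U] /eqP x0g].
  apply: le_trans (colour_bijections_fixed_le R cv c2 (x0^-1)%g (touched U)).
  apply: ler_wpM2r; first by apply: prodr_ge0 => v _; exact: ltW.
  rewrite ler_nat; apply: subset_leq_card; apply/fintype.subsetP => x.
  rewrite !inE => /andP[/andP[xc xU] /eqP xg]; rewrite xc /=.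
  apply/forall_inP => v vB.
  suff <- : (x^-1)%g v = (x0^-1)%g v by rewrite permKV.
  apply: (traverses_determined xU x0U Un) vB => u uR.
  by have := congr1 (fun f : {ffun _} => f u) (etrans xg (esym x0g)); rewrite !ffunE uR.
have XE : #|X|%:R = \sum_(g in pfamily i0 Rt cls) #|[set x in X | loc x == g]%SET|%:R :> R.
  rewrite -sum1_card (partition_big loc (mem (pfamily i0 Rt cls))) /=.
    rewrite natr_sum; apply: eq_bigr => g _; rewrite -sum1_card.
    by congr (_%:R); apply: eq_bigl => x; rewrite !inE.
  move=> x; rewrite inE => /andP[xc _]; apply/pfamilyP; split.
    by apply/fintype.subsetP => v; rewrite inE ffunE; case: ifP => //; rewrite eqxx.
  move=> v vR; rewrite ffunE vR unfold_in /cls.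
  move: xc; rewrite inE => /forallP/(_ ((x^-1)%g v)); rewrite permKV.
  by rewrite eq_sym.
have sub : h @: U \subset touched U.
  by apply/fintype.subsetP => _ /imsetP[e eU ->]; apply: touchedP (hU e eU).
have prodB : \prod_(v in touched U) (colour_class cv (cv v))%:R =
   \prod_(v in Rt) (colour_class cv (cv v))%:R *
   \prod_(v in h @: U) (colour_class cv (cv v))%:R :> R.
  rewrite (bigID (mem (h @: U))) /= mulrC; congr (_ * _).
    by apply: eq_bigl => v; rewrite inE andbC.
  by apply: eq_bigl => v; case: (boolP (v \in h @: U)); rewrite ?andbF // andbT;
    apply: (fintype.subsetP sub).
have prodR : 0 < \prod_(v in Rt) (colour_class cv (cv v))%:R :> R.
  by apply: prodr_gt0.
rewrite -(ler_pM2l prodR) mulrCA -prodB XE big_distrl /=.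
apply: le_trans (ler_sum _ (fun g _ => fib g)) _.
rewrite sumr_const card_pfamily_prod -[X in X <= _]mulr_natl natr_prod.
by apply: ler_wpM2r; rewrite ?mulr_ge0 ?exprn_ge0 ?expR_ge0 // ler_prod // => v _;
  rewrite csE lexx ler0n.
Qed.

Lemma card_cycle_edges (n : nat) (x : {perm 'I_n}) :
  (#|cycle_edges x| <= n)%N.
Proof.
rewrite -(card_imset _ val_inj) -[X in (_ <= X)%N]card_ord.
apply: leq_trans (leq_imset_card (fun i => [set x i; x (ordS i)]%SET) predT).
apply: subset_leq_card; apply/fintype.subsetP => _ /imsetP[e + ->].
by rewrite inE => /existsP[i /eqP ->]; apply: imset_f.
Qed.

(** Summing over the end at which each edge is entered gives [2 ^+ #|U|]; distinct edges have
    distinct heads, each worth a factor [b]; and at most [2 * #|U|] touched vertices cost [expR 1]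
    each. *)
Lemma card_cycles_through_le (R : realType) (n l : nat)
    (cv c2 : 'I_n -> 'I_l) (b : R) (U : {set vpair n}) :
  (forall j, colour_class c2 j = colour_class cv j) -> 0 < b ->
  (forall v, b <= (colour_class cv (cv v))%:R) -> (#|U| < n)%N ->
  #|[set x in colour_bijections cv c2 | U \subset cycle_edges x]%SET|%:R <=
  (2 * expR 1 ^+ 2 / b) ^+ #|U| * #|colour_bijections cv c2|%:R.
Proof.
move=> cc b0 bcls Un; have n0 : (0 < n)%N by exact: leq_ltn_trans Un.
pose i0 : 'I_n := Ordinal n0.
set X := [set x in _ | _]%SET.
set N := #|colour_bijections cv c2|.
pose head (x : {perm 'I_n}) : {ffun vpair n -> 'I_n} := [ffun e =>
  if e \in U then x (ordS (odflt i0 [pick i | val e == [set x i; x (ordS i)]%SET]))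
  else i0].
pose ends (e : vpair n) := fun v : 'I_n => v \in val e.
have headP x : x \in X -> traverses x U (head x).
  rewrite inE => /andP[_ /fintype.subsetP xU]; apply/forall_inP => e eU.
  have := xU e eU; rewrite inE => /existsP[i ei].
  rewrite ffunE eU; case: pickP => [j ej|/(_ i)]; last by rewrite ei.
  by apply/existsP; exists j; rewrite ej /=.
have head_ends x : x \in X -> head x \in pfamily i0 (mem U) ends.
  move=> /headP/forall_inP xU; apply/pfamilyP; split.
    by apply/fintype.subsetP => e; rewrite inE ffunE; case: ifP => //; rewrite eqxx.
  move=> e eU; have /existsP[i /andP[/eqP ei /eqP <-]] := xU e eU.
  by rewrite unfold_in /ends ei set22.
(* Two edges entered at the same vertex occupy the same position of the cycle. *)
have inj (h : {ffun vpair n -> 'I_n}) x : traverses x U h -> {in U &, injective h}.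
  move=> /forall_inP xU e e' eU e'U hh.
  have /existsP[i /andP[/eqP ei /eqP hi]] := xU e eU.
  have /existsP[i' /andP[/eqP ei' /eqP hi']] := xU e' e'U.
  have ii : i = i'.
    by apply: (can_inj (@ordSK n)); apply: (@perm_inj _ x); rewrite hi hi'.
  by apply: val_inj; rewrite ei ei' ii.
have e1 : 1 <= expR 1 :> R by rewrite -expR0 ler_expR.
have fib (h : {ffun vpair n -> 'I_n}) : h \in pfamily i0 (mem U) ends ->
    #|[set x in X | head x == h]%SET|%:R <= (expR 1 ^+ 2 / b) ^+ #|U| * N%:R :> R.
  move=> /pfamilyP[_ hU].
  have [->|[x0]] := finset.set_0Vmem [set x in X | head x == h]%SET.
    by rewrite cards0 mulr_ge0 // exprn_ge0 // divr_ge0 ?exprn_ge0 ?expR_ge0 // ltW.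
  rewrite inE => /andP[x0X /eqP x0h]; have := headP _ x0X; rewrite x0h => x0U.
  rewrite expr_div_n mulrAC ler_pdivlMr ?exprn_gt0 //.
  apply: (@le_trans _ _ (#|[set x in colour_bijections cv c2 | traverses x U h]%SET|%:R *
     \prod_(v in h @: U) (colour_class cv (cv v))%:R)).
    apply: ler_pM; rewrite ?exprn_ge0 //; first exact: ltW.
      rewrite ler_nat; apply: subset_leq_card; apply/fintype.subsetP => x.
      rewrite inE => /andP[xX /eqP xh]; rewrite inE -xh headP // andbT.
      by move: xX; rewrite inE => /andP[].
    rewrite -(card_in_imset (inj h x0 x0U)) -prodr_const.
    by apply: ler_prod => v _; rewrite bcls (ltW b0).
  apply: le_trans (card_traverses_le R cc Un _) _ => //.
  apply: ler_wpM2r => //; rewrite -exprM; apply: ler_weXn2l => //.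
  exact: card_touched.
rewrite -sum1_card (partition_big head (mem (pfamily i0 (mem U) ends))) //=.
rewrite natr_sum.
apply: (@le_trans _ _ (\sum_(h in pfamily i0 (mem U) ends)
   (expR 1 ^+ 2 / b) ^+ #|U| * N%:R)).
  apply: ler_sum => h /fib; rewrite -sum1_card.
  by congr (_%:R <= _); apply: eq_bigl => x; rewrite !inE.
rewrite sumr_const card_pfamily_prod (eq_bigr (fun=> 2%N)) => [|e _].
  rewrite prod_nat_const -[X in X <= _]mulr_natl natrX mulrA -exprMn.
  by rewrite [2 * (_ / b)]mulrA.
exact: eqP (valP e).
Qed.

(** The constant 4 in place of 2 leaves a slack of [2 ^+ #|U|], which pays for the case [#|U| = n],
    where [U] may be a whole cycle and the count above does not apply. *)
Lemma cycle_edges_spread (R : realType) (n l : nat)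
    (cv c2 : 'I_n -> 'I_l) (b : R) :
  (forall j, colour_class c2 j = colour_class cv j) -> 0 < b ->
  (forall v, b <= (colour_class cv (cv v))%:R) ->
  spread #|colour_bijections cv c2|%:R (b / (4 * expR 1 ^+ 2))
    (colour_bijections cv c2) (@cycle_edges n).
Proof.
move=> cc b0 bcls U; set N := #|colour_bijections cv c2|.
have e1 : 1 <= expR 1 :> R by rewrite -expR0 ler_expR.
set E2 : R := expR 1 ^+ 2.
have E21 : 1 <= E2 by exact: exprn_ege1.
rewrite invf_div mulrC.
have x0 : 0 < 2 * E2 / b by rewrite divr_gt0 // mulr_gt0 //; lra.
have -> : 4 * E2 / b = 2 * (2 * E2 / b) by rewrite !mulrA; congr (_ * _ / _); ring.
move rE : (2 * E2 / b) x0 => r r0.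
have [Un|nU] := ltnP #|U| n.
  apply: le_trans (card_cycles_through_le cc b0 bcls Un) _.
  rewrite -/E2 rE; apply: ler_wpM2r => //; rewrite exprMn -[X in X <= _]mul1r.
  by apply: ler_wpM2r; rewrite ?exprn_ge0 ?exprn_ege1 ?ler1n // ltW.
have [U0|[e eU]] := finset.set_0Vmem U.
  have n0 : n = 0%N by move: nU; rewrite U0 cards0 leqn0 => /eqP.
  rewrite U0 cards0 expr0 mul1r ler_nat; apply: subset_leq_card.
  by apply/fintype.subsetP => x; rewrite inE => /andP[].
have [Un|nU'] := leqP #|U| n; last first.
  rewrite (_ : [set _ in _ | _]%SET = finset.set0).
    by rewrite cards0 mulr_ge0 // exprn_ge0 // mulr_ge0 // ltW.
  apply/finset.setP => x; rewrite !inE; apply/negP => /andP[_ /subset_leq_card].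
  by rewrite leqNgt (leq_ltn_trans (card_cycle_edges x)).
(* With [#|U| = n], one pair is dropped; the slack makes up for the lost factor because
   [b <= n <= 2 ^ n]. *)
have Ue : (#|U :\ e|%SET).+1 = #|U| by rewrite (finset.cardsD1 e U) eU.
have Uen : (#|U :\ e|%SET < n)%N by rewrite Ue.
apply: (@le_trans _ _ (#|[set x in colour_bijections cv c2 |
    (U :\ e)%SET \subset cycle_edges x]%SET|%:R)).
  rewrite ler_nat; apply: subset_leq_card; apply/fintype.subsetP => x.
  rewrite !inE => /andP[-> Ux] /=; apply: fintype.subset_trans Ux.
  exact: finset.subsetDl.
apply: le_trans (card_cycles_through_le cc b0 bcls Uen) _.
rewrite -/E2 rE; apply: ler_wpM2r => //.
rewrite exprMn -{2}Ue exprS mulrA -[X in X <= _]mul1r.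
apply: ler_wpM2r; first by rewrite exprn_ge0 // ltW.
rewrite -rE !mulrA ler_pdivlMr // mul1r.
have n0 := leq_ltn_trans (leq0n _) Uen.
apply: (le_trans (bcls (Ordinal n0))).
apply: (@le_trans _ _ (2 ^+ #|U|)).
  rewrite -natrX ler_nat; apply: (@leq_trans n).
    by rewrite -[X in (_ <= X)%N]card_ord; apply: max_card.
  by apply: leq_trans nU _; exact: ltnW (ltn_expl _ _).
have : 0 < 2 ^+ #|U| :> R by rewrite exprn_gt0.
move=> y0; rewrite -!mulrA ler_peMr ?(ltW y0) //.
rewrite -expr2 -/E2; apply: le_trans E21 _.
by rewrite ler_peMl ?ler1n // exprn_ge0 // expR_ge0.
Qed.

(** * From edge sets to coloured Hamilton cycles *)

Lemma colour_bijections_gt0 (n l : nat) (cv c2 : 'I_n -> 'I_l) :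
  (forall j, colour_class c2 j = colour_class cv j) ->
  (0 < #|colour_bijections cv c2|)%N.
Proof.
move=> cc.
(* Equal class sizes make the two colour sequences rearrangements of each other. *)
have : perm_eq [tuple c2 i | i < n] [tuple cv i | i < n].
  have H (c : 'I_n -> 'I_l) j : count_mem j [tuple c i | i < n] = colour_class c j.
    rewrite /= count_map /colour_class cardsE cardE size_filter enumT.
    by apply: eq_count.
  by apply/allP => j _ /=; rewrite !H cc.
case/tuple_permP => s sE; apply/card_gt0P; exists s; rewrite inE.
apply/forallP => i; have := congr1 (fun t => nth (c2 i) t i) sE.
rewrite -!tnth_nth !tnth_mktuple => ->.
by [].
Qed.

Lemma ordS_neq (n : nat) (i : 'I_n) : (1 < n)%N -> ordS i != i.
Proof.
move=> n1; rewrite -val_eqE /=; have ni := ltn_ord i.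
have [E|ne] := eqVneq i.+1 n; first by rewrite E modnn; lia.
by rewrite modn_small; lia.
Qed.

Lemma ordS2_neq (n : nat) (i : 'I_n) : (2 < n)%N -> ordS (ordS i) != i.
Proof.
move=> n2; rewrite -val_eqE /=; have ni := ltn_ord i.
have [E|ne] := eqVneq i.+1 n; first by rewrite E modnn modn_small; lia.
rewrite (@modn_small i.+1); last by lia.
have [E|ne'] := eqVneq i.+2 n; first by rewrite E modnn; lia.
by rewrite modn_small; lia.
Qed.

(** The only alternative is that [i] and [j] are successors of each other, which needs a cycle of
    length at most 2. *)
Lemma cycle_edge_inj (n : nat) (x : {perm 'I_n}) (i j : 'I_n) : (2 < n)%N ->
  [set x i; x (ordS i)]%SET = [set x j; x (ordS j)]%SET -> i = j.
Proof.
move=> n2 E.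
have /set2P[/perm_inj //|/perm_inj ij] : x i \in [set x j; x (ordS j)]%SET.
  by rewrite -E set21.
have /set2P[/perm_inj ji|/perm_inj/(can_inj (@ordSK n)) //] :
    x (ordS i) \in [set x j; x (ordS j)]%SET by rewrite -E set22.
by have := ordS2_neq j n2; rewrite -ij ji eqxx.
Qed.

(** The colour [c0] is a filler for pairs off the cycle; on the cycle the position is unique once
    [n > 2]. *)
Definition edge_colour (n k : nat) (c0 : 'I_k) (c1 : 'I_n -> 'I_k)
    (x : {perm 'I_n}) (e : vpair n) : 'I_k :=
  if [pick i | val e == [set x i; x (ordS i)]%SET] is Some i then c1 i else c0.

Lemma coloured_cycle_has_coloured_ham_cycle (n k l : nat) (c0 : 'I_k)
    (cv c2 : 'I_n -> 'I_l) (c1 : 'I_n -> 'I_k) (g : ecgraph n k) :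
  (2 < n)%N ->
  [exists x in colour_bijections cv c2, [forall e in cycle_edges x,
     (e \in finset.set0) || (g e == Some (edge_colour c0 c1 x e))]] ->
  has_coloured_ham_cycle cv c1 c2 g.
Proof.
move=> n2 /exists_inP[x]; rewrite inE => /forallP xc /forall_inP xg.
rewrite /has_coloured_ham_cycle n2; apply/existsP; exists x.
apply/forallP => i; rewrite xc /=.
have card2 : #|[set x i; x (ordS i)]%SET| == 2%N.
  by rewrite cards2 (inj_eq perm_inj) [i == _]eq_sym ordS_neq // ltnW.
pose e : vpair n := Sub [set x i; x (ordS i)]%SET card2.
apply/existsP; exists e; rewrite eqxx /=.
have ex : e \in cycle_edges x by rewrite inE; apply/existsP; exists i; rewrite eqxx.
have := xg e ex; rewrite inE /= => /eqP ->; apply/eqP; congr Some.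
rewrite /edge_colour; case: pickP => [j /eqP ej|/(_ i)]; last by rewrite eqxx.
by congr c1; apply/esym/(@cycle_edge_inj n x).
Qed.

Lemma sum_option (R : nmodType) (T : finType) (F : option T -> R) :
  \sum_t F t = F None + \sum_i F (Some i).
Proof.
rewrite (bigD1 None) //=; congr (_ + _).
rewrite (reindex_omap Some id) => [|[]//].
by apply: eq_bigl => i; rewrite eqxx.
Qed.

(** The distance to 1 is the probability of failure, and failure forces [coloured_miss] with empty
    [W], to which [mcdiarmid] applies. *)
Lemma ecgraph_prob_ge (R : realType) (n k l : nat) (c0 : 'I_k)
    (cv c2 : 'I_n -> 'I_l) (c1 : 'I_n -> 'I_k) (p q : R) (alpha : 'I_k -> R) :
  (2 < n)%N -> (forall i, 0 < alpha i) -> \sum_i alpha i = 1 ->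
  0 <= p <= 1 -> 0 <= q <= 1 -> (forall i, q <= p * alpha i) ->
  `| ecgraph_prob p alpha (has_coloured_ham_cycle cv c1 c2) - 1 | <=
  sprinkle q (enum (vpair n : finType))
    (miss R (colour_bijections cv c2) (@cycle_edges n)) finset.set0.
Proof.
move=> n2 a0 a1 /andP[p0 p1] /andP[q0 q1] qa.
pose w (t : option 'I_k) : R := if t is Some i then p * alpha i else 1 - p.
have w0 t : 0 <= w t.
  by case: t => [i|] /=; [rewrite mulr_ge0 // ltW | rewrite subr_ge0].
have w1 : \sum_t w t = 1.
  by rewrite sum_option /= -big_distrr /= a1 mulr1 subrK.
have wE : 1 = \sum_(g : ecgraph n k) \prod_e w (g e).
  by rewrite -(bigA_distr_bigA (fun _ => w)) big1.
have pg0 (g : ecgraph n k) : 0 <= \prod_e w (g e) by exact: prodr_ge0.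
set A := has_coloured_ham_cycle cv c1 c2.
have -> : ecgraph_prob p alpha A - 1 =
    - \sum_(g : ecgraph n k | ~~ A g) \prod_e w (g e).
  have -> : ecgraph_prob p alpha A = \sum_(g | A g) \prod_e w (g e) by [].
  by rewrite [X in _ - X]wE [X in _ - X](bigID A) /= opprD addrA subrr sub0r.
rewrite normrN ger0_norm; last exact: sumr_ge0.
apply: le_trans (mcdiarmid (colour_bijections cv c2) (@cycle_edges n)
  (edge_colour c0 c1) w0 w1 q0 q1 qa).
rewrite [X in _ <= X](bigID A) /=; apply: ler_wpDl.
  by apply: sumr_ge0 => g _; rewrite mulr_ge0 ?pg0 // /coloured_miss ler0n.
apply: ler_sum => g nA; rewrite /coloured_miss.
set b := [exists x in _, _]; suff /negbTE-> : ~~ b by rewrite mulr1.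
by apply: contra nA; exact: coloured_cycle_has_coloured_ham_cycle.
Qed.

(** * Logarithmic estimates and the choice of constants *)

Lemma ln2_ge (R : realType) : 2^-1 <= ln 2 :> R.
Proof.
rewrite -[X in X <= _]expRK ler_ln ?posrE ?expR_gt0 //.
rewrite -[2^-1]opprK expRN -[X in _ <= X]invrK lef_pV2 ?posrE ?expR_gt0 ?invr_gt0 //.
by apply: le_trans (expR_ge1Dx _); lra.
Qed.

(** From [2 ^ (L - 1) <= n] and [ln 2 >= 1 / 2] comes [L <= 2 * ln n + 1]; the 1 is absorbed since
    [ln n >= 1]. *)
Lemma up_log_le_ln (R : realType) (n : nat) : (4 <= n)%N ->
  (up_log 2 n)%:R <= 3 * ln n%:R :> R.
Proof.
move=> n4; have n0 : 0 < n%:R :> R by rewrite ltr0n; lia.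
have ln2 := ln2_ge R.
have ln1 : 1 <= ln n%:R :> R.
  apply: (@le_trans _ _ (ln (2 ^+ 2))); first by rewrite lnXn // mulr2n; lra.
  by rewrite ler_ln ?posrE ?exprn_gt0 // -natrX ler_nat.
have := up_log_gtn (isT : 1 < 2)%N (leq_trans (isT : 1 < 4)%N n4).
have : (0 < up_log 2 n)%N by rewrite up_log_gt0 /=; lia.
case: (up_log 2 n) => // L _ /ltnW; rewrite -pred_Sn => Ln.
have : ln (2 ^+ L) <= ln n%:R :> R.
  by rewrite ler_ln ?posrE ?exprn_gt0 // -natrX ler_nat.
rewrite lnXn // -[X in X <= _ -> _]mulr_natl -(natr1 L) => H.
suff : L%:R * 2^-1 <= L%:R * ln 2 :> R by lra.
by apply: ler_wpM2l.
Qed.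

Lemma ln_le_sqrt (R : realType) (n : nat) : (0 < n)%N ->
  ln n%:R <= 2 * Num.sqrt n%:R :> R.
Proof.
move=> n0; have s0 : 0 < Num.sqrt n%:R :> R by rewrite sqrtr_gt0 ltr0n.
have lns : ln (Num.sqrt n%:R) <= Num.sqrt n%:R :> R.
  have := @le_ln1Dx R (Num.sqrt n%:R - 1); rewrite [1 + _]addrC subrK => H.
  by apply: le_trans (H _) _; lra.
by rewrite -{1}(@sqr_sqrtr _ n%:R) // lnXn // mulr2n; lra.
Qed.

Lemma finite_lower_bound (R : realType) (k : nat) (a : 'I_k -> R) :
  (forall i, 0 < a i) -> exists2 a0, 0 < a0 <= 1 & forall i, a0 <= a i.
Proof.
move=> a0; exists (\big[Order.min/1]_i a i); last by move=> i; exact: bigmin_le_cond.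
by rewrite lt_bigmin //= bigmin_le_id.
Qed.

Theorem theorem4 (R : realType) (k l : nat) (hk : (1 <= k)%N) (hl : (1 <= l)%N)
    (alpha : 'I_k -> R) (alpha_gt0 : forall i, 0 < alpha i)
    (alpha_sum : \sum_(i < k) alpha i = 1)
    (beta : 'I_l -> R) (beta_gt0 : forall j, 0 < beta j)
    (beta_sum : \sum_(j < l) beta j = 1) :
  exists K0 : R, forall K : R, K0 <= K ->
    forall eps : R, 0 < eps ->
    \forall n \near \oo,
      forall (c1 : 'I_n -> 'I_k) (c2 : 'I_n -> 'I_l) (cv : 'I_n -> 'I_l),
        colour_counts beta c2 -> colour_counts beta cv ->
        `| ecgraph_prob (K * ln n%:R / n%:R) alpha
             (has_coloured_ham_cycle cv c1 c2) - 1 | < eps.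
Proof.
have [a /andP[a0 a1] aalpha] := finite_lower_bound alpha_gt0.
have [b /andP[b0 b1] bbeta] := finite_lower_bound beta_gt0.
pose E2 : R := 4 * expR 1 ^+ 2.
have E20 : 0 < E2 by rewrite mulr_gt0 // exprn_gt0 // expR_gt0.
(* Here [kappa = b * n / E2], and the threshold [9 * L / kappa] with [L <= 3 * ln n] is at most
   [27 * E2 * ln n / (b * n)]; this [K0] brings it below [q = a * K * ln n / n]. *)
exists (27 * E2 / (a * b)) => K KK eps e0.
have ab0 : 0 < a * b by rewrite mulr_gt0.
have K0 : 0 < K by apply: lt_le_trans KK; rewrite divr_gt0 // mulr_gt0.
have Kab : 27 * E2 <= a * b * K by rewrite [a * b * K]mulrC -ler_pdivrMr.
have [L0 HL] := hitting_threshold (divr_gt0 e0 (ltr0n R 2)).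
(* The three bounds serve the logarithmic estimate, [L0 <= L], and [p <= 1] respectively. *)
exists (maxn (maxn 4 (2 ^ L0)) (Num.bound ((2 * K) ^+ 2))) => // n /=.
rewrite !geq_max => /andP[/andP[n4 nL0] nbound] c1 c2 cv h2 hv.
have n_gt0 : (0 < n)%N := leq_trans (isT : 0 < 4)%N n4.
have nK : (2 * K) ^+ 2 <= n%:R.
  apply: ltW; apply: lt_le_trans (archi_boundP _) _; last by rewrite ler_nat; exact: nbound.
  by rewrite exprn_ge0 // mulr_ge0 // ltW.
have n0 : 0 < n%:R :> R by rewrite ltr0n.
pose L := up_log 2 n; have LL : L%:R <= 3 * ln n%:R :> R by exact: up_log_le_ln.
have ln0 : 0 <= ln n%:R :> R by rewrite ln_ge0 // ler1n.
set p := K * ln n%:R / n%:R.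
have p0 : 0 <= p by rewrite divr_ge0 ?mulr_ge0 // ltW.
have p1 : p <= 1.
  rewrite /p ler_pdivrMr // mul1r.
  have s0 : 0 <= Num.sqrt n%:R :> R by rewrite sqrtr_ge0.
  have sK : 2 * K <= Num.sqrt n%:R.
    have K20 : 0 <= 2 * K by rewrite mulr_ge0 // ltW.
    by rewrite -(ger0_norm K20) -sqrtr_sqr ler_wsqrtr.
  apply: (@le_trans _ _ (K * (2 * Num.sqrt n%:R))).
    by apply: ler_wpM2l; [exact: ltW | exact: ln_le_sqrt].
  rewrite -[X in _ <= X]sqr_sqrtr ?(ltW n0) // expr2 mulrCA mulrA.
  exact: ler_wpM2r.
pose q := p * a.
have q0 : 0 <= q by rewrite mulr_ge0 // ltW.
have qp : q <= p by rewrite /q ler_piMr.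
have cc j : colour_class c2 j = colour_class cv j.
  by apply/eqP; rewrite -(eqr_nat R) /colour_class h2 hv.
have bcls v : b * n%:R <= (colour_class cv (cv v))%:R.
  by rewrite /colour_class hv ler_pM2r.
have bn0 : 0 < b * n%:R by rewrite mulr_gt0.
apply: (@le_lt_trans _ _ (eps / 2)); last by rewrite gtr_pMr // invf_lt1 // ltr1n.
apply: le_trans (@ecgraph_prob_ge _ _ _ _ (Ordinal hk) cv c2 c1 p q _ _ alpha_gt0 alpha_sum _ _ _) _.
- exact: ltnW.
- by rewrite p0.
- by rewrite q0 (le_trans qp).
- by move=> i; apply: ler_wpM2l.
(* The spread bound holds with [M] equal to the number of bijections, so this positive factor can be
   cancelled from [hitting]. *)
have N0 : 0 < #|colour_bijections cv c2|%:R :> R.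
  by rewrite ltr0n colour_bijections_gt0.
rewrite -(ler_pM2l N0).
apply: (HL L (vpair n) _ (b * n%:R / E2) q n) => //.
- have := leq_trans nL0 (up_logP n (isT : 1 < 2)%N).
  by rewrite leq_exp2l.
- by rewrite divr_gt0.
- exact: up_logP.
- rewrite ler_pdivrMr ?divr_gt0 // natrM /q /p.
  have -> : K * ln n%:R / n%:R * a * (b * n%:R / E2) = a * b * K * ln n%:R / E2.
    by field; rewrite !gt_eqF.
  rewrite ler_pdivlMr //.
  apply: (@le_trans _ _ (27 * E2 * ln n%:R)); last exact: ler_wpM2r.
  have : 9 * E2 * L%:R <= 9 * E2 * (3 * ln n%:R).
    by apply: ler_wpM2l => //; rewrite mulr_ge0 // ltW.
  by move: (L%:R : R) (ln n%:R : R) => x y; lra.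
- exact: le_trans qp p1.
- exact: cycle_edges_spread.
- by move=> x _; exact: card_cycle_edges.
Qed.
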